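(* Consider a Markov decision process with state space $\mathbb{X}$, action space $\mathbb{A}$, one-step cost $c$ and transition kernel $q$, satisfying Assumptions S* and B (as defined in the context). Let $\{\alpha_n\}_{n\ge 1}\subset[0,1)$ be a sequence of discount factors with $\alpha_n\uparrow 1$ such that: (a) $\lim_{n\to\infty} u_{\alpha_n}(x)$ exists for each $x\in\mathbb{X}$; (b) for each $x\in\mathbb{X}$ and $a\in\mathbb{A}$ the sequence $\{u_{\alpha_n}\}_{n\ge 1}$ is asymptotically uniformly integrable with respect to $q(\cdot|x,a)$. Let $u(x):=\liminf_{n\to\infty}u_{\alpha_n}(x)$, $x\in\mathbb{X}$. Then there exists a stationary policy $\phi$ such that for all $x\in\mathbb{X}$ $$w^*+u(x)=c(x,\phi(x))+\int_{\mathbb{X}}u(y)\,q(dy|x,\phi(x))=\min_{a\in\mathbb{A}}\Big[c(x,a)+\int_{\mathbb{X}}u(y)\,q(dy|x,a)\Big].$$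
   Context: MDP. $\mathbb{X}$ and $\mathbb{A}$ are Borel subsets of Polish spaces; $c:\mathbb{X}\times\mathbb{A}\to[-\infty,+\infty]$ is measurable and bounded below (the value $+\infty$ is allowed); $q(B|x,a)$ is a (regular, measurable) transition probability from $\mathbb{X}\times\mathbb{A}$ to $\mathbb{X}$. Every action in $\mathbb{A}$ is available at every state. Histories: $H_t=(\mathbb{X}\times\mathbb{A})^t\times\mathbb{X}$. A policy $\pi=(\pi_0,\pi_1,\dots)$ is a sequence of regular transition probabilities $\pi_t(\cdot|h_t)$ from $H_t$ to $\mathbb{A}$; $\Pi$ is the set of all policies. A stationary policy is a non-randomized policy whose decisions depend only on the current state; it is identified with a measurable function $\phi:\mathbb{X}\to\mathbb{A}$. An initial state $x$ and a policy $\pi$ define, by the Ionescu Tulcea theorem, a unique probability on $(\mathbb{X}\times\mathbb{A})^\infty$ with expectation $\mathbb{E}_x^\pi$. Costs. $v_{N,\alpha}^\pi(x)=\mathbb{E}_x^\pi\sum_{t=0}^{N-1}\alpha^t c(x_t,a_t)$; for $\alpha\in[0,1)$, $v_\alpha^\pi(x)$ is the same with $N=\infty$, and $v_\alpha(x)=\inf_{\pi\in\Pi}v_\alpha^\pi(x)$. Average cost: $w_1^\pi(x)=\limsup_{N\to\infty}\frac1N v_{N,1}^\pi(x)$, $w_1(x)=\inf_{\pi\in\Pi}w_1^\pi(x)$, $w^*=\inf_{x\in\mathbb{X}}w_1(x)$. Set $m_\alpha=\inf_{x\in\mathbb{X}}v_\alpha(x)$ and $u_\alpha(x)=v_\alpha(x)-m_\alpha$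 (well defined under Assumption B(i), which implies $m_\alpha<+\infty$). Assumption S*: (i) for each $x\in\mathbb{X}$ the function $a\mapsto c(x,a)$ is inf-compact on $\mathbb{A}$, i.e. $\{a\in\mathbb{A}:c(x,a)\le\lambda\}$ is compact for every $\lambda\in\mathbb{R}$; (ii) for each $x\in\mathbb{X}$, $q(\cdot|x,a)$ is setwise continuous in $a\in\mathbb{A}$, i.e. $a_n\to a$ implies $q(B|x,a_n)\to q(B|x,a)$ for every Borel $B\subset\mathbb{X}$. Assumption B: (i) $w^*<+\infty$; (ii) $\sup_{\alpha\in[0,1)}u_\alpha(x)<+\infty$ for every $x\in\mathbb{X}$. Asymptotic uniform integrability of $\{f_n\}$ with respect to a measure $\mu$: $\lim_{K\to+\infty}\limsup_{n\to\infty}\int|f_n|\,\mathbf{1}\{|f_n|\ge K\}\,d\mu=0$. *)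

(* Defs.v *)
From HB Require Import structures.
From mathcomp Require Import all_boot all_order all_algebra.
From mathcomp Require Import all_classical all_reals all_analysis.
From mathcomp Require Import measurable_realfun.

Set Implicit Arguments.
Unset Strict Implicit.
Unset Printing Implicit Defensive.

Import Order.TTheory GRing.Theory Num.Theory.
Import numFieldNormedType.Exports.

Local Open Scope classical_set_scope.
Local Open Scope ring_scope.
Local Open Scope ereal_scope.

(* [T] with its Borel sigma-algebra, as a measurable type. *)
Notation borel T := (g_sigma_algebraType (@open T)).

(* A Hausdorff complete pseudometric is a complete metric, so [P] below is a
   Polish space with a compatible complete metric; [T] is presented through
   the inclusion [i] as a Borel subset of [P] with the subspace topology. *)
Definition borel_subset_of_polish (R : realType) (T : topologicalType) : Prop :=
  exists (P : completePseudoMetricType R) (i : T -> P),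
    [/\ hausdorff_space P,
        exists2 D : set P, countable D & dense D,
        injective i,
        (forall U : set T, open U <-> exists2 V : set P, open V & U = i @^-1` V)
      & <<s @open P >> (range i)].

Section mdp.
(* Measurable types are pointed in the library, hence the pointed spaces; for
   empty [X] or [A] one would have [wstar = +oo], against [assumption_B]. *)
Context {R : realType} {X A : ptopologicalType}.

Definition bounded_below (c : borel X * borel A -> \bar R) : Prop :=
  exists M : R, forall z, M%:E <= c z.

Definition history (t : nat) : Type :=
  (t.-tuple (borel X * borel A) * borel X)%type.

Definition policy : Type := forall t : nat, R.-pker (history t) ~> borel A.

(* The product sigma-algebra on sequences of state-action pairs. *)
Definition cylinder : set (set (nat -> borel X * borel A)) :=
  [set C | exists (t : nat) (F : set (borel X * borel A)),
     measurable F /\ C = [set w | F (w t)]].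

Definition trajectory : Type := g_sigma_algebraType cylinder.

Definition steps (t : nat) (w : trajectory) : t.-tuple (borel X * borel A) :=
  [tuple w i | i < t].

Definition history_of (t : nat) (w : trajectory) : history t :=
  (steps t w, (w t).1).

(* The initial state is [x], the conditional law of the action a_t given h_t is
   [pi t h_t], and that of x_{t+1} given (h_t, a_t) is [q (x_t, a_t)]. *)
Definition is_strategic_measure (q : R.-pker (borel X * borel A) ~> borel X)
    (pi : policy) (x : X) (P : probability trajectory R) : Prop :=
  [/\ forall B : set (borel X), measurable B ->
        P [set w | B (w 0%N).1] = \d_(x : borel X) B,
      forall (t : nat) (E : set (history t)) (D : set (borel A)),
        measurable E -> measurable D ->
        P [set w | E (history_of t w) /\ D (w t).2] =
        \int[P]_(w in [set w | E (history_of t w)]) pi t (history_of t w) D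
    & forall (t : nat) (E : set (t.+1.-tuple (borel X * borel A)))
             (B : set (borel X)),
        measurable E -> measurable B ->
        P [set w | E (steps t.+1 w) /\ B (w t.+1).1] =
        \int[P]_(w in [set w | E (steps t.+1 w)]) q (w t) B].

(* The default value of [xget] is never used: by the Ionescu Tulcea theorem
   there is exactly one strategic measure for each policy and initial state. *)
Definition strategic_measure (q : R.-pker (borel X * borel A) ~> borel X)
    (pi : policy) (x : X) : probability trajectory R :=
  xget (\d_(point : trajectory) : probability trajectory R)
    [set P | is_strategic_measure q pi x P].

Section costs.
Variables (c : borel X * borel A -> \bar R)
          (q : R.-pker (borel X * borel A) ~> borel X).

Definition finite_horizon_cost (N : nat) (alpha : R) (pi : policy) (x : X) :
    \bar R :=
  \int[strategic_measure q pi x]_w \sum_(0 <= t < N) (alpha ^+ t)%:E * c (w t).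

Definition discounted_cost (alpha : R) (pi : policy) (x : X) : \bar R :=
  \int[strategic_measure q pi x]_w \sum_(0 <= t <oo) (alpha ^+ t)%:E * c (w t).

Definition discounted_value (alpha : R) (x : X) : \bar R :=
  ereal_inf [set discounted_cost alpha pi x | pi in [set: policy]].

Definition average_cost (pi : policy) (x : X) : \bar R :=
  limn_esup (fun N => (N%:R^-1)%:E * finite_horizon_cost N 1 pi x).

Definition average_value (x : X) : \bar R :=
  ereal_inf [set average_cost pi x | pi in [set: policy]].

Definition wstar : \bar R := ereal_inf [set average_value x | x in [set: X]].

Definition min_discounted_value (alpha : R) : \bar R :=
  ereal_inf [set discounted_value alpha x | x in [set: X]].

Definition relative_value (alpha : R) (x : X) : \bar R :=
  discounted_value alpha x - min_discounted_value alpha.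

Definition assumption_Sstar : Prop :=
  (forall (x : X) (l : R), compact [set a : A | c (x, a) <= l%:E]) /\
  (forall (x : X) (s : nat -> A) (a : A), s @ \oo --> a ->
     forall B : set (borel X), measurable B ->
       q (x, s n) B @[n --> \oo] --> q (x, a) B).

Definition assumption_B : Prop :=
  wstar < +oo /\
  (forall x : X,
     ereal_sup [set relative_value alpha x | alpha in `[0%R, 1%R[ ] < +oo).

End costs.
End mdp.

Definition asymptotically_uniformly_integrable (R : realType)
    (d : measure_display) (T : measurableType d)
    (mu : {measure set T -> \bar R}) (f : nat -> T -> \bar R) : Prop :=
  limn_esup (fun n =>
    \int[mu]_y (`|f n y| * (\1_[set z | (K%:E <= `|f n z|)%E] y)%:E))
      @[K --> (+oo)%R] --> 0.

(* Main.v *)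
Require Import Defs.
From HB Require Import structures.
From mathcomp Require Import all_boot all_order all_algebra.
From mathcomp Require Import all_classical all_reals all_analysis.
From mathcomp Require Import measurable_realfun.
From mathcomp Require Import ring lra zify.

Set Implicit Arguments.
Unset Strict Implicit.
Unset Printing Implicit Defensive.

Import Order.TTheory GRing.Theory Num.Theory.
Import numFieldNormedType.Exports.

Local Open Scope classical_set_scope.
Local Open Scope ring_scope.
Local Open Scope ereal_scope.

(** Subtract a lower bound [M] from [c] to get a nonnegative cost [g].  Value
iteration yields measurable discounted values solving the optimality equation
  (1 - alpha) m_alpha + u_alpha (x) = min_a [g (x, a) + alpha int u_alpha dq].
Let [W] be the upper limit of (1 - alpha_n) m_{alpha_n}.  Asymptotic uniform
integrability passes to the limit under the integral and gives
  W + u (x) <= g (x, a) + int u dq  for every [a].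
Conversely, replace alpha_n u_{alpha_n} by its increasing lower envelopes
inf_{n >= k}; compactness of the level sets in the action lets the minimum
commute with the increasing limit, so that some action satisfies the reverse
inequality.  Hence equality holds at a measurable minimizer [phi].  Iterating
it along the trajectory bounds the average cost of [phi] by W + M, while an
Abelian argument shows that W + M is at most the average cost of any policy;
hence w^* = W + M.

Measurability of minima over a non-compact action space rests on selection from
measurable sets with compact sections: the projection of such a set and its
complement are both analytic, hence Borel by Souslin separation. *)

(** * Analytic sets *)

(** Inf-compactness gives only lower semicontinuity in the action, so an infimum over actions is not
    an infimum over a countable dense set of them; its level sets are genuinely projections, whose
    measurability is a matter of descriptive set theory. The argument runs in the sigma-algebra of
    bianalytic sets, which tolerates products and injective images; Souslin's theorem returns to
    Borel sets at the end of the projection theorem.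

    The shift by [M] costs only constants: it adds M / (1 - alpha) to discounted values, which
    cancels in u_alpha, and M to averages. Since costs may be infinite, finiteness comes from
    Assumption B alone: w^* bounds m_alpha, then u_alpha bounds v_alpha, and only then can a
    minimizer be selected.

    An upper limit [W] serves both inequalities. A bound valid for all large n passes to it, and
    conversely the terms are eventually below [W] + eps, where a single large n is enough. *)

Definition agree (S : Type) (n : nat) (w w' : nat -> S) : Prop :=
  forall i, (i < n)%N -> w i = w' i.

Definition dep (S T : Type) (n : nat) (f : (nat -> S) -> T) : Prop :=
  forall w w', agree n w w' -> f w = f w'.

Definition upd (S : Type) (n : nat) (w : nat -> S) (s : S) : nat -> S :=
  fun i => if i == n then s else w i.

Section sequences_of_choices.
Context {S : Type}.
Implicit Types (w : nat -> S) (s : S).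

Lemma agree_refl n w : agree n w w. Proof. by []. Qed.

Lemma agree_sym n w w' : agree n w w' -> agree n w' w.
Proof. by move=> h i /h. Qed.

Lemma agree_trans n w1 w2 w3 : agree n w1 w2 -> agree n w2 w3 -> agree n w1 w3.
Proof. by move=> h h' i ni; rewrite h// h'. Qed.

Lemma agreeW n m w w' : (n <= m)%N -> agree m w w' -> agree n w w'.
Proof. by move=> nm h i ni; apply: h; exact: leq_trans nm. Qed.

Lemma agree_upd n w s : agree n w (upd n w s).
Proof. by move=> i ni; rewrite /upd ltn_eqF. Qed.

Lemma upd_agree n w w' s : agree n w w' -> agree n.+1 (upd n w s) (upd n w' s).
Proof.
move=> h i; rewrite ltnS /upd; case: eqP => // /eqP ni ni'; apply: h.
by rewrite ltn_neqAle ni.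
Qed.

Lemma updE n w s : upd n w s n = s. Proof. by rewrite /upd eqxx. Qed.

Lemma upd_id n w : upd n w (w n) = w.
Proof. by apply/funext => i; rewrite /upd; case: eqP => [->|]. Qed.

Lemma depW (T : Type) n m (f : (nat -> S) -> T) : (n <= m)%N -> dep n f -> dep m f.
Proof. by move=> nm h w w' /(agreeW nm); exact: h. Qed.

(** Each stage settles one more coordinate, and invariance under agreement carries the property of
    stage n to the diagonal sequence. This drives Novikov separation, the Koenig argument and the
    Ionescu Tulcea construction. *)
Lemma dependent_choice_upd (P : nat -> (nat -> S) -> Prop) w0 :
  (forall n w w', agree n w w' -> P n w -> P n w') ->
  P 0%N w0 -> (forall n w, P n w -> exists s, P n.+1 (upd n w s)) ->
  exists w, forall n, P n w.
Proof.
move=> Pdep P0 PS.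
have /choice[g Pg] : forall nw : nat * (nat -> S), exists s, P nw.1 nw.2 -> P nw.1.+1 (upd nw.1 nw.2 s).
  move=> [n w] /=; have [/PS[s ?]|nP] := pselect (P n w); first by exists s.
  by exists (w 0%N).
pose W := fix W n := if n is m.+1 then upd m (W m) (g (m, W m)) else w0.
have PW n : P n (W n) by elim: n => //= n ih; exact: (Pg (n, W n)).
have agW n m : (n <= m)%N -> agree n (W n) (W m).
  move=> /subnK <-; elim: (m - n)%N => [|k ih]; first exact: agree_refl.
  rewrite addSn; apply: agree_trans ih _; apply: agreeW (agree_upd _ _).
  by rewrite leq_addl.
(* [W n.+1] is the first approximation in which coordinate n is settled. *)
exists (fun n => W n.+1 n) => n; apply: (Pdep n (W n)) => // i ni.
by rewrite (agW i.+1 n ni).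
Qed.

End sequences_of_choices.

(** Pairing lets one point of the Baire space carry countably many; the map to the slices is onto
    and, by [slice_agree], continuous. *)
Definition slice (z : nat -> nat) (i : nat) : nat -> nat :=
  fun m => z (pickle (i, m)).

Lemma slice_surj (y : nat -> nat -> nat) : exists z, forall i, slice z i = y i.
Proof.
exists (fun k => if unpickle k is Some (i, m) then y i m else 0%N) => i.
by apply/funext => m; rewrite /slice pickleK.
Qed.

Lemma slice_agree i n : exists k, forall z z', agree k z z' ->
  agree n (slice z i) (slice z' i).
Proof.
exists (\max_(m < n) (pickle (i, m : nat)).+1)%N => z z' h m mn; apply: h.
exact: (@leq_bigmax _ (fun m : 'I_n => (pickle (i, m : nat)).+1) (Ordinal mn)).
Qed.

Section analytic.
Context {T : topologicalType}.
Implicit Types (S F : set T) (rho : (nat -> nat) -> set T).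

(** The first alternative says that [z] is interior to the complement of the domain, the second that
    [rho] is continuous at [z] with value [x]. *)
Definition souslin_map rho : Prop := forall z,
  (exists n, forall z', agree n z z' -> rho z' = set0) \/
  (exists2 x, rho z x &
     forall U, nbhs x U -> exists n, forall z', agree n z z' -> rho z' `<=` U).

(* Equivalently, [S] is the continuous image of a closed subset of the Baire
   space; sections of [rho] may contain extra points as long as they shrink. *)
Definition analytic S : Prop :=
  exists2 rho, souslin_map rho & S = \bigcup_z rho z.

Definition bianalytic S : Prop := analytic S /\ analytic (~` S).

Lemma analytic0 : analytic set0.
Proof.
exists (fun=> set0); last by rewrite bigcup0.
by move=> z; left; exists 0%N.
Qed.

(** The first term of a code selects the set, the remaining terms code the point in it. *)
Lemma analytic_bigcup (S : (set T)^nat) :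
  (forall n, analytic (S n)) -> analytic (\bigcup_n S n).
Proof.
move=> aS; have /choice[rho /all_and2[rhoP SE]] : forall n, exists rho,
    souslin_map rho /\ S n = \bigcup_z rho z.
  by move=> n; have [rho] := aS n; exists rho.
exists (fun z => rho (z 0%N) (fun m => z m.+1)).
  move=> z; have [[n hn]|[x zx hx]] := rhoP (z 0%N) (fun m => z m.+1).
    left; exists n.+1 => z' zz'; rewrite -(zz' 0%N)//; apply: hn => i ni.
    exact: zz'.
  right; exists x => // U /hx[n hn]; exists n.+1 => z' zz'.
  by rewrite -(zz' 0%N)//; apply: hn => i ni; exact: zz'.
apply/seteqP; split => [x [n _]|x [z _ zx]]; last first.
  by exists (z 0%N) => //; rewrite SE; exists (fun m => z m.+1).
rewrite SE => -[z _ zx].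
by exists (fun k => if k is m.+1 then z m else n).
Qed.

Lemma analyticU S S' : analytic S -> analytic S' -> analytic (S `|` S').
Proof.
move=> aS aS'; rewrite -bigcup2E; apply: analytic_bigcup => -[|[|n]] //=.
exact: analytic0.
Qed.

(** If the limit point lies outside [F], the complement of [F] is one of its neighbourhoods, so
    nearby sections miss [F]: closedness supplies the local emptiness. *)
Lemma analyticI_closed S F : analytic S -> closed F -> analytic (S `&` F).
Proof.
move=> [rho rhoP ->] cF; exists (fun z => rho z `&` F); last by rewrite setI_bigcupl.
move=> z; have [[n hn]|[x zx hx]] := rhoP z.
  by left; exists n => z' /hn ->; rewrite set0I.
have [Fx|nFx] := pselect (F x).
  right; exists x => // U /hx[n hn]; exists n => z' /hn zz' y [yz' _].
  exact: zz'.
left; have /hx[n hn] : nbhs x (~` F).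
  by apply: open_nbhs_nbhs; split => //; exact: closed_openC.
by exists n => z' /hn; rewrite -disjoints_subset.
Qed.

Hypothesis hT : hausdorff_space T.

Lemma hausdorff_separate (x y : T) : x != y ->
  exists U V, [/\ open_nbhs x U, open_nbhs y V & U `&` V = set0].
Proof.
move=> xy; have := hT; rewrite open_hausdorff => /(_ _ _ xy)[[U V]] /= [].
rewrite !inE => Ux Vy [oU oV UV0]; exists U, V; split => //.
Qed.

(** A code carries one code per set, read through [slice]. If the limit points of the slices are not
    all equal, two of them have disjoint neighbourhoods, and finitely many terms of the code already
    force an empty intersection. *)
Lemma analytic_bigcap (S : (set T)^nat) :
  (forall n, analytic (S n)) -> analytic (\bigcap_n S n).
Proof.
move=> aS; have /choice[rho /all_and2[rhoP SE]] : forall n, exists rho,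
    souslin_map rho /\ S n = \bigcup_z rho z.
  by move=> n; have [rho] := aS n; exists rho.
exists (fun z => \bigcap_i rho i (slice z i)); last first.
  apply/seteqP; split => [x Sx|x [z _ zx] i _]; last first.
    by rewrite SE; exists (slice z i) => //; exact: zx.
  have /choice[y yP] : forall i, exists z, rho i z x.
    by move=> i; have := Sx i I; rewrite SE => -[z _ zx]; exists z.
  by have [z zE] := slice_surj y; exists z => // i _; rewrite zE.
move=> z.
have [[i [n hn]]|nex] := pselect (exists i, exists n, forall z',
    agree n (slice z i) z' -> rho i z' = set0).
  left; have [k hk] := slice_agree i n; exists k => z' zz'.
  by apply/seteqP; split => // x /(_ i I); rewrite (hn _ (hk _ _ zz')).
have /choice[x xP] : forall i, exists x, rho i (slice z i) x /\
    forall U, nbhs x U -> exists n, forall z', agree n (slice z i) z' -> rho i z' `<=` U.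
  move=> i; have [h|[x zx hx]] := rhoP i (slice z i); last by exists x.
  by exfalso; apply: nex; exists i.
have hx i U : nbhs (x i) U -> exists k, forall z', agree k z z' ->
    rho i (slice z' i) `<=` U.
  move=> /(proj2 (xP i))[n hn]; have [k hk] := slice_agree i n.
  by exists k => z' zz'; exact/hn/hk.
have [xE|/existsNP[i xi]] := pselect (forall i, x i = x 0%N).
  right; exists (x 0%N); first by move=> i _; rewrite -(xE i); exact: (xP i).1.
  by move=> U /hx[k hk]; exists k => z' /hk zz' y yi; apply: zz'; exact: yi.
left; have /eqP/hausdorff_separate[U [V [/open_nbhs_nbhs/hx[k hk]]]] := xi.
move=> /open_nbhs_nbhs/hx[l hl] UV0.
exists (maxn k l) => z' zz'; apply/seteqP; split => // y yz'; rewrite -UV0; split.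
  by apply: (hk z'); [apply: agreeW zz'; rewrite leq_maxl|exact: yz'].
by apply: (hl z'); [apply: agreeW zz'; rewrite leq_maxr|exact: yz'].
Qed.

Lemma analyticI S S' : analytic S -> analytic S' -> analytic (S `&` S').
Proof.
move=> aS aS'.
have -> : S `&` S' = \bigcap_n (if n is 0%N then S else S').
  apply/seteqP; split => [x [Sx S'x] [|n] _ //|x h].
  by split; [exact: (h 0%N)|exact: (h 1%N)].
by apply: analytic_bigcap => -[].
Qed.

Lemma bianalyticC S : bianalytic S -> bianalytic (~` S).
Proof. by move=> [? ?]; split => //; rewrite setCK. Qed.

Lemma bianalytic_bigcup (S : (set T)^nat) :
  (forall n, bianalytic (S n)) -> bianalytic (\bigcup_n S n).
Proof.
move=> bS; split; first by apply: analytic_bigcup => n; exact: (bS n).1.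
by rewrite setC_bigcup; apply: analytic_bigcap => n; exact: (bS n).2.
Qed.

End analytic.

Lemma bianalytic_sigma_algebra (T : topologicalType) : hausdorff_space T ->
  analytic [set: T] -> sigma_algebra [set: T] (@bianalytic T).
Proof.
move=> hT aT; split; first by split; [exact: analytic0|rewrite setC0].
- by move=> A bA; rewrite setTD; exact: bianalyticC.
- by move=> A bA; exact: bianalytic_bigcup.
Qed.

(** * Novikov separation of countably many analytic sets *)

Section novikov.
Context {T : topologicalType} (M : set (set T)).
Hypothesis sM : sigma_algebra [set: T] M.
Hypothesis sepM : forall x y : T, x != y ->
  exists U V, [/\ M U, M V, nbhs x U, nbhs y V & U `&` V = set0].

Let separated (S : (set T)^nat) := exists B : (set T)^nat,
  [/\ forall i, M (B i), forall i, S i `<=` B i & \bigcap_i B i = set0].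

Let MC A : M A -> M (~` A).
Proof. by case: sM => _ MD _ MA; rewrite -setTD; exact: MD. Qed.

Let MT : M setT.
Proof. by rewrite -setC0; apply: MC; case: sM. Qed.

Let Mbigcap (A : (set T)^nat) : (forall n, M (A n)) -> M (\bigcap_n A n).
Proof.
move=> MA; rewrite -(setCK (\bigcap_n A n)) setC_bigcap; apply: MC.
by case: sM => _ _; apply => n; exact: MC.
Qed.

(** If there is no separation, the terms of a common code can be fixed one at a time while the coded
    parts stay inseparable. The slices of the limit code then include one that is locally empty, or
    shrink to points two of which differ, and both cases are separable at a finite stage; or they
    shrink to a common point of all [S i]. *)
Lemma novikov_separation (S : (set T)^nat) : (forall i, analytic (S i)) ->
  \bigcap_i S i = set0 -> exists B : (set T)^nat,
  [/\ forall i, M (B i), forall i, S i `<=` B i & \bigcap_i B i = set0].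
Proof.
move=> aS S0; rewrite -/(separated S).
have /choice[rho /all_and2[rhoP SE]] : forall i, exists rho,
    souslin_map rho /\ S i = \bigcup_z rho z.
  by move=> i; have [rho] := aS i; exists rho.
(* [Q k z i] is the part of [S i] reached by codes that begin with the first k terms of [z]; all
   [S i] share one code through its slices. *)
pose Q (k : nat) (z : nat -> nat) (i : nat) :=
  [set x | exists2 z', agree k z z' & rho i (slice z' i) x].
have QE k z z' : agree k z z' -> Q k z = Q k z'.
  move=> zz'; apply/funext => i; apply/seteqP; split => x [y zy yx]; exists y => //.
    exact: agree_trans (agree_sym zz') zy.
  exact: agree_trans zz' zy.
have Q0 z : Q 0%N z = S.
  apply/funext => i; rewrite SE; apply/seteqP; split => x.
    by move=> [y _ yx]; exists (slice y i).
  move=> [y _ yx]; have [z' z'E] := slice_surj (fun=> y).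
  by exists z' => //; rewrite z'E.
apply: contrapT => nsep.
have [||k z nz|z nz] := @dependent_choice_upd _ (fun k z => ~ separated (Q k z)) (fun=> 0%N).
- by move=> k z z' /QE ->.
- by rewrite Q0.
- apply: contrapT => /forallNP sep; apply: nz.
  have /choice[B BP] : forall j, exists B : (set T)^nat, [/\ forall i, M (B i),
     forall i, Q k.+1 (upd k z j) i `<=` B i & \bigcap_i B i = set0].
    by move=> j; have /contrapT := sep j.
  (* Only slice [i0] reads term k, so fixing that term splits the part at [i0] alone: separators at
     [i0] are united over the values [j] of the term, those at other indices are intersected. If k
     codes no pair, no slice reads it and the default is harmless. *)
  pose i0 : nat := (odflt (0%N, 0%N) (unpickle k)).1.
  exists (fun i => if i == i0 then \bigcup_j B j i else \bigcap_j B j i); split.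
  + move=> i; case: ifP => _; last by apply: Mbigcap => j; have [] := BP j.
    by case: sM => _ _; apply => j; have [] := BP j.
  + move=> i x [y zy yx]; case: ifPn => [_|ii0].
      exists (y k) => //; have [_ h _] := BP (y k); apply: h; exists y => //.
      by rewrite -{2}(upd_id k y); exact: upd_agree.
    move=> j _; have [_ h _] := BP j; apply: h; exists (upd k y j).
      exact: upd_agree.
    have -> // : slice (upd k y j) i = slice y i.
    apply/funext => m; rewrite /slice /upd; case: eqP => // kE.
    by move: ii0; rewrite /i0 -kE pickleK eqxx.
  + apply/seteqP; split => // x h.
    have := h i0 I; rewrite eqxx => -[j _ xj].
    have [_ _ <-] := BP j => i _; have [->//|ii0] := eqVneq i i0.
    by have := h i I; rewrite (negbTE ii0); apply.
have Qsub i U : (exists n, forall z', agree n (slice z i) z' -> rho i z' `<=` U) ->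
    exists k, Q k z i `<=` U.
  move=> [n hn]; have [k hk] := slice_agree i n.
  by exists k => x [z' zz']; apply: hn; exact: hk.
have [[i [n hn]]|nex] := pselect (exists i, exists n, forall z',
    agree n (slice z i) z' -> rho i z' = set0).
  have [k hk] : exists k, Q k z i `<=` set0.
    by apply: Qsub; exists n => z' /hn ->.
  apply: (nz k); exists (fun j => if j == i then set0 else setT); split.
  - by move=> j; case: ifP => // _; case: sM.
  - by move=> j; case: eqP => [->|].
  - by apply/seteqP; split => // x /(_ i I); rewrite eqxx.
have /choice[x xP] : forall i, exists x, rho i (slice z i) x /\
    forall U, nbhs x U -> exists n, forall z', agree n (slice z i) z' -> rho i z' `<=` U.
  move=> i; have [h|[x zx hx]] := rhoP i (slice z i); last by exists x.
  by exfalso; apply: nex; exists i.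
have [xE|/existsNP[i /eqP xi]] := pselect (forall i, x i = x 0%N).
  suff : (\bigcap_i S i) (x 0%N) by rewrite S0.
  by move=> i _; rewrite SE; exists (slice z i) => //; rewrite -(xE i); exact: (xP i).1.
have [U [V [MU MV xU xV UV0]]] := sepM xi.
have [k hk] := Qsub i U ((xP i).2 U xU).
have [l hl] := Qsub 0%N V ((xP 0%N).2 V xV).
have i0 : i != 0%N by apply: contraNneq xi => ->.
have QS m n j : (n <= m)%N -> Q m z j `<=` Q n z j.
  by move=> nm y [z' zz' ?]; exists z' => //; apply: agreeW zz'.
apply: (nz (maxn k l)).
exists (fun j => if j == i then U else if j == 0%N then V else setT); split.
- by move=> j; case: ifP => // _; case: ifP.
- move=> j y; case: eqP => [->|_] yQ; first by apply/hk/(QS _ _ _ _ _ yQ)/leq_maxl.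
  by case: eqP yQ => [->|//] yQ; apply/hl/(QS _ _ _ _ _ yQ)/leq_maxr.
- apply/seteqP; split => // y h; rewrite -UV0; split.
    by have := h i I; rewrite eqxx.
  by have := h 0%N I; rewrite eqxx eq_sym (negbTE i0).
Qed.

(** Novikov separation applied to [E] together with all complements of the [C n]: their joint
    intersection is empty because the [C n] cover [E], and the complements of the separators refine
    the cover. *)
Corollary coanalytic_cover (E : set T) (C : (set T)^nat) : analytic E ->
  (forall n, analytic (~` C n)) -> E `<=` \bigcup_n C n ->
  exists D : (set T)^nat,
    [/\ forall n, M (D n), forall n, D n `<=` C n & E `<=` \bigcup_n D n].
Proof.
move=> aE aC EC.
have [||B [MB SB B0]] := @novikov_separation
    (fun n => if n is m.+1 then ~` C m else E).
- by case.
- apply/seteqP; split => // x h; have /EC[n _ Cn] := h 0%N I.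
  exact: (h n.+1 I).
exists (fun n => ~` B n.+1); split => [n|n x|x Ex]; first exact: MC.
  by apply: contra_notP => nC; exact: (SB n.+1).
apply: contrapT => h; suff : (\bigcap_i B i) x by rewrite B0.
case=> [|n] _; first exact: (SB 0%N).
by apply: contrapT => nB; apply: h; exists n.
Qed.

(** Souslin's theorem: [E] is covered by the constant sequence [E], so the refined cover consists of
    sets of [M] and has union [E]. *)
Corollary bianalytic_in_sigma_algebra (E : set T) : bianalytic E -> M E.
Proof.
move=> [aE aEC]; have [|||D [MD DE ED]] := @coanalytic_cover E (fun=> E).
- exact: aE.
- by [].
- by move=> x Ex; exists 0%N.
suff -> : E = \bigcup_n D n by case: sM => _ _; exact.
by apply/seteqP; split => // x [n _]; exact: DE.
Qed.

End novikov.

Section analytic_operations.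

Lemma analytic_image (T U : topologicalType) (f : T -> U) (S : set T) :
  continuous f -> analytic S -> analytic (f @` S).
Proof.
move=> cf [rho rhoP ->]; exists (fun z => f @` rho z); last by rewrite image_bigcup.
move=> z; have [[n hn]|[x zx hx]] := rhoP z.
  by left; exists n => z' /hn ->; rewrite image_set0.
right; exists (f x); first by exists x.
move=> V /(cf x)/hx[n hn]; exists n => z' /hn h _ [y yz' <-]; exact: h.
Qed.

Lemma analyticX (T U : topologicalType) (A : set T) (B : set U) :
  analytic A -> analytic B -> analytic (A `*` B).
Proof.
move=> [r rP ->] [s sP ->].
exists (fun z => r (slice z 0) `*` s (slice z 1)); last first.
  apply/seteqP; split => [[x y] [[a _ ax] [b _ bx]]|[x y] [z _ [zx zy]]].
    have [z zE] := slice_surj (fun i => if i is 0%N then a else b).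
    by exists z => //; split; rewrite zE.
  by split; [exists (slice z 0)|exists (slice z 1)].
move=> z.
have [[n hn]|[x zx hx]] := rP (slice z 0).
  left; have [k hk] := slice_agree 0 n; exists k => z' /hk/hn ->.
  by rewrite set0X.
have [[n hn]|[y zy hy]] := sP (slice z 1).
  left; have [k hk] := slice_agree 1 n; exists k => z' /hk/hn ->.
  by rewrite setX0.
right; exists (x, y) => // W [[V1 V2] /= [/hx[n hn] /hy[m hm]] VW].
have [k hk] := slice_agree 0 n; have [l hl] := slice_agree 1 m.
exists (maxn k l) => z' zz' [a b] [az' bz']; apply: VW; split => /=.
  by apply: hn az'; apply: hk; apply: agreeW zz'; exact: leq_maxl.
by apply: hm bz'; apply: hl; apply: agreeW zz'; exact: leq_maxr.
Qed.

Lemma analytic_embedding (T U : topologicalType) (i : T -> U) :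
  injective i -> (forall V, open V -> exists2 W, open W & V = i @^-1` W) ->
  analytic (range i) -> analytic [set: T].
Proof.
move=> inji emb [rho rhoP iE].
exists (fun z => i @^-1` rho z); last first.
  apply/seteqP; split => // x _.
  have : range i (i x) by exists x.
  by rewrite iE => -[z _ zx]; exists z.
move=> z; have [[n hn]|[y zy hy]] := rhoP z.
  by left; exists n => z' /hn ->; rewrite preimage_set0.
have [x _ xy] : range i y by rewrite iE; exists z.
right; exists x; first by rewrite /= xy.
move=> V; rewrite nbhsE => -[V' [oV' V'x] V'V].
have [W oW WE] := emb _ oV'.
have /hy[n hn] : nbhs y W.
  by apply: open_nbhs_nbhs; split => //; move: V'x; rewrite WE /= xy.
exists n => z' /hn h t /h; rewrite -[W (i t)]/((i @^-1` W) t) -WE; exact: V'V.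
Qed.

End analytic_operations.

Section bianalytic_product.
Context {X Y : topologicalType}.
Hypotheses (aX : analytic [set: X]) (aY : analytic [set: Y]).

Lemma bianalyticX (A : set X) (B : set Y) :
  bianalytic A -> bianalytic B -> bianalytic (A `*` B).
Proof.
move=> [aA aAC] [aB aBC]; split; first exact: analyticX.
have -> : ~` (A `*` B) = (~` A `*` setT) `|` (setT `*` ~` B).
  apply/seteqP; split => [[x y] /= /not_andP[]|[x y] /= [[nA _] [/nA//]|[_ nB] [_ /nB//]]].
    by left.
  by right.
by apply: analyticU; apply: analyticX.
Qed.

Lemma hausdorff_prod : hausdorff_space X -> hausdorff_space Y ->
  hausdorff_space (X * Y)%type.
Proof.
move=> hX hY [x1 y1] [x2 y2] cl; congr pair.
- apply: hX => A B Ax By.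
  have [||[x y] [/= ? ?]] := cl (fst @^-1` A) (fst @^-1` B); last by exists x.
  + exact: cvg_fst.
  + exact: cvg_fst.
- apply: hY => A B Ax By.
  have [||[x y] [/= ? ?]] := cl (snd @^-1` A) (snd @^-1` B); last by exists y.
  + exact: cvg_snd.
  + exact: cvg_snd.
Qed.

End bianalytic_product.

Lemma borel_bianalytic (T : topologicalType) : hausdorff_space T ->
  analytic [set: T] ->
  (forall O : set T, open O ->
     exists F : (set T)^nat, (forall n, closed (F n)) /\ O = \bigcup_n F n) ->
  <<s @open T>> `<=` @bianalytic T.
Proof.
move=> hT aT Fs; apply: smallest_sub; first exact: bianalytic_sigma_algebra.
move=> O oO; split; last first.
  by rewrite -(setTI (~` O)); apply: analyticI_closed => //; exact: open_closedC.
have [F [cF ->]] := Fs O oO; apply: analytic_bigcup => n.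
by rewrite -(setTI (F n)); exact: analyticI_closed.
Qed.

(** * Polish spaces are analytic and their Borel sets bianalytic *)

Section polish.
Context {R : realType} {P : completePseudoMetricType R}.

Let e (m : nat) : R := m.+1%:R^-1%R.

Let e_gt0 m : (0 < e m)%R. Proof. by rewrite invr_gt0. Qed.

Let e_small (eps : R) : (0 < eps)%R -> exists m, (e m < eps)%R.
Proof.
move=> e0; have [m _ /(_ m (leqnn m))] := near_infty_natSinv_lt (PosNum e0).
by exists m.
Qed.

(** Completeness: points of the finite intersections form a Cauchy sequence with limit [p]. The sets
    [W m] may be open, so [p] can escape them; what survives is that finite intersections enter
    every neighbourhood of [p]. *)
Lemma shrinking_cvg (r : nat -> R) (c : nat -> P) (W : (set P)^nat) :
  (forall eps : R, (0 < eps)%R -> exists m, (r m < eps)%R) ->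
  (forall m, W m `<=` ball (c m) (r m)) ->
  (forall M, exists y, forall m, (m < M)%N -> W m y) ->
  exists p : P, forall U, nbhs p U ->
    exists M, forall y, (forall m, (m < M)%N -> W m y) -> U y.
Proof.
move=> r0 Wb /choice[y yW].
have yc : cauchy (y @ \oo).
  apply: cauchy_exP => eps /r0[m rm]; exists (c m); exists m.+1 => // n /= mn.
  by apply: le_ball (ltW rm) _ _; apply: Wb; exact: yW.
have [p yp] : exists p : P, y @ \oo --> p.
  by exists (lim (y @ \oo)); exact: cauchy_cvg.
exists p => U /nbhs_ballP[eps /= eps0 pU].
have [m rm] : exists m, (r m < eps / 4)%R by apply: r0; rewrite divr_gt0.
exists m.+1 => z zW; apply: pU.
have [N _ hN] : \forall n \near \oo, ball p (eps / 2) (y n).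
  by apply: yp; apply: nbhsx_ballx; rewrite divr_gt0.
have yN := hN (maxn N m.+1) (leq_maxl _ _).
have yWm := Wb m _ (yW (maxn N m.+1) m (leq_maxr _ _)).
have zWm := Wb m _ (zW m (ltnSn m)).
have -> : eps = (eps / 2 + (eps / 4 + eps / 4))%R by field.
apply: ball_triangle yN _; apply: (@ball_triangle _ _ (c m)).
  by apply: ball_sym; apply: le_ball (ltW rm) _ yWm.
exact: le_ball (ltW rm) _ zWm.
Qed.

Hypothesis hP : hausdorff_space P.
Variable (a : nat -> P).
Hypothesis a_dense : forall O : set P, O !=set0 -> open O -> exists j, O (a j).

(** A ball of a pseudometric structure need not be open, hence the interior. *)
Let V m j : set P := (ball (a j) (e m))°.

Let V_cover m p : exists j, V m j p.
Proof.
have e2 : (0 < e m / 2)%R by rewrite divr_gt0.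
have [j pj] : exists j, (ball p (e m / 2))° (a j).
  apply: a_dense (@open_interior _ _); exists p.
  exact: (@open_nbhs_ball _ _ p (PosNum e2)).2.
exists j; apply/nbhs_ballP; exists (e m / 2)%R => //= y py.
apply: ball_split py; apply: ball_sym.
exact: interior_subset pj.
Qed.

Let V_ball m j : V m j `<=` ball (a j) (e m).
Proof. exact: interior_subset. Qed.

Lemma closure_ball_subset (x : P) (eps : R) : (0 < eps)%R ->
  closure (ball x eps) `<=` ball x (eps + eps).
Proof.
move=> e0 y /(_ (ball y eps) (nbhsx_ballx _ _ e0))[z [xz yz]].
by apply: ball_triangle xz _; exact: ball_sym.
Qed.

Let closed_base p O : nbhs p O ->
  exists m j, V m j p /\ closure (V m j) `<=` O.
Proof.
move=> /nbhs_ballP[eps /= eps0 pO].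
have [m em] : exists m, (e m < eps / 3)%R by apply: e_small; rewrite divr_gt0.
have [j Vp] := V_cover m p; exists m, j; split => // y yV; apply: pO.
have -> : eps = (eps / 3 + (eps / 3 + eps / 3))%R by field.
apply: (@ball_triangle _ _ (a j)).
  by apply: ball_sym; apply: le_ball (ltW em) _ _; exact: V_ball.
have : closure (ball (a j) (e m)) y by apply: closure_subset yV; exact: V_ball.
move=> /(closure_ball_subset (e_gt0 m)); apply: le_ball.
by rewrite lerD// ltW.
Qed.

(** A code names one ball of the countable family at each scale. Closures are taken so that the
    limit of a consistent code lies in its section; an inconsistent code has an empty finite
    intersection, which is the local emptiness. *)
Lemma analytic_polish : analytic [set: P].
Proof.
exists (fun z => \bigcap_m closure (V m (z m))); last first.
  apply/seteqP; split => // p _; have /choice[z zP] := V_cover ^~ p.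
  by exists z => // m _; exact: subset_closure.
move=> z.
have [h|/existsNP[M nM]] := pselect (forall M, exists y, forall m,
    (m < M)%N -> closure (V m (z m)) y); last first.
  left; exists M => z' zz'; apply/seteqP; split => // y yz'.
  by apply: nM; exists y => m mM; rewrite zz'//; exact: yz'.
have [||p pP] := @shrinking_cvg (fun m => e m + e m)%R (fun m => a (z m)) _ _ _ h.
- move=> eps e0; have [m em] : exists m, (e m < eps / 2)%R.
    by apply: e_small; rewrite divr_gt0.
  by exists m; rewrite [ltRHS](splitr eps) ltrD.
- move=> m; apply: subset_trans (closure_ball_subset (e_gt0 m)).
  by apply: closure_subset; exact: V_ball.
right; exists p.
  move=> m _; apply: contrapT => npm.
  have [M hM] : exists M, forall y, (forall m, (m < M)%N -> closure (V m (z m)) y) ->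
      (~` closure (V m (z m))) y.
    apply: pP; apply: open_nbhs_nbhs; split => //.
    exact/closed_openC/closed_closure.
  have [y hy] := h (maxn M m.+1); apply: (hM y); last first.
    by apply: hy; exact: leq_maxr.
  by move=> k kM; apply: hy; exact: leq_trans (leq_maxl _ _).
move=> U /pP[M hM]; exists M => z' zz' y yz'; apply: hM => m mM.
by rewrite zz'//; exact: yz'.
Qed.

Lemma open_Fsigma (O : set P) : open O ->
  exists F : (set P)^nat, (forall n, closed (F n)) /\ O = \bigcup_n F n.
Proof.
move=> oO; exists (fun n => if unpickle n is Some (m, j) then
  (if `[< closure (V m j) `<=` O >] then closure (V m j) else set0) else set0).
split.
  move=> n; case: (unpickle n) => [[m j]|]; last exact: closed0.
  by case: ifP => _; [exact: closed_closure|exact: closed0].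
apply/seteqP; split => [p Op|p [n _]]; last first.
  by case: (unpickle n) => // -[m j]; case: ifP => // /asboolP h; exact: h.
have [m [j [Vp VO]]] : exists m j, V m j p /\ closure (V m j) `<=` O.
  by apply: closed_base; exact: open_nbhs_nbhs.
exists (pickle (m, j)) => //; rewrite pickleK.
by rewrite asboolT//; exact: subset_closure.
Qed.

Lemma polish_borel_bianalytic : <<s @open P>> `<=` @bianalytic P.
Proof. by apply: borel_bianalytic => //; [exact: analytic_polish|exact: open_Fsigma]. Qed.

(** * Projection of bianalytic sets with compact sections *)

Section projection.
Context {X : ptopologicalType}.
Hypotheses (hX : hausdorff_space X) (aX : analytic [set: X]).
Hypothesis oX : forall O : set X, open O -> bianalytic O.

Let oP (O : set P) : open O -> bianalytic O.
Proof. by move=> oO; apply: polish_borel_bianalytic; exact: sub_sigma_algebra. Qed.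

Let aP := analytic_polish.

Let bT (Y : topologicalType) : analytic [set: Y] -> bianalytic [set: Y].
Proof. by move=> aY; split => //; rewrite setCT; exact: analytic0. Qed.

Let sepX (x y : X) : x != y -> exists U V,
  [/\ bianalytic U, bianalytic V, nbhs x U, nbhs y V & U `&` V = set0].
Proof.
move=> /(hausdorff_separate hX)[U [W [xU yW UW]]]; exists U, W.
by split => //; [exact: oX xU.1|exact: oX yW.1|exact: open_nbhs_nbhs..].
Qed.

Let sepXP (x y : X * P) : x != y -> exists U V,
  [/\ bianalytic U, bianalytic V, nbhs x U, nbhs y V & U `&` V = set0].
Proof.
case: x y => [x p] [y r] xy.
have [xE|xny] := eqVneq x y.
  have /(hausdorff_separate hP)[U [W [xU yW UW]]] : p != r.
    by apply: contra_neq xy => ->; rewrite xE.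
  exists (setT `*` U), (setT `*` W); split.
  - by apply: bianalyticX => //; [exact: bT|exact: oP xU.1].
  - by apply: bianalyticX => //; [exact: bT|exact: oP yW.1].
  - exists (setT, U) => //; split => /=; [exact: filterT|exact: open_nbhs_nbhs].
  - exists (setT, W) => //; split => /=; [exact: filterT|exact: open_nbhs_nbhs].
  - apply/seteqP; split => // -[s t] [[_ /= tU] [_ /= tV]].
    by have : (U `&` W) t by []; rewrite UW.
have /(hausdorff_separate hX)[U [W [xU yW UW]]] := xny.
exists (U `*` setT), (W `*` setT); split.
- by apply: bianalyticX => //; [exact: oX xU.1|exact: bT].
- by apply: bianalyticX => //; [exact: oX yW.1|exact: bT].
- exists (U, setT) => //; split => /=; [exact: open_nbhs_nbhs|exact: filterT].
- exists (W, setT) => //; split => /=; [exact: open_nbhs_nbhs|exact: filterT].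
- apply/seteqP; split => // -[s t] [[/= sU _] [/= sV _]].
  by have : (U `&` W) s by []; rewrite UW.
Qed.

(* [K] has compact sections.  Its total boundedness at scale [e m] is witnessed
   by bianalytic sets [D m k], and the open sections of its complement by
   rectangles [B n `*` U n]; a section is empty iff, by Koenig's lemma, some
   finite level of the tree of balls is covered by the [U n]. *)
Lemma bianalytic_projection (K : set (X * P)) : bianalytic K ->
  (forall x, compact [set p | K (x, p)]) -> bianalytic (fst @` K).
Proof.
move=> [aK aKC] cK.
have hXP := hausdorff_prod hX hP.
have aXP : analytic [set: X * P] by rewrite -setXTT; exact: analyticX.
have sX := bianalytic_sigma_algebra hX aX.
have sXP := bianalytic_sigma_algebra hXP aXP.
have cfst : continuous (fst : X * P -> X) by move=> x; exact: cvg_fst.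
have csnd : continuous (snd : X * P -> P) by move=> x; exact: cvg_snd.
pose C m k := [set x | forall p, K (x, p) -> exists2 j, (j < k)%N & V m j p].
(* By compactness the sets [C m k], for varying k, cover the state space. Each is coanalytic, its
   complement being a projection, so the cover can be refined to bianalytic sets [D m k]. *)
have /choice[D DP] m : exists D : (set X)^nat,
    [/\ forall k, bianalytic (D k), forall k, D k `<=` C m k &
        setT `<=` \bigcup_k D k].
  apply: (coanalytic_cover sX sepX aX).
  - move=> k; pose F := \bigcap_(j in `I_k) ~` V m j.
    have -> : ~` C m k = fst @` (K `&` (snd @^-1` F)).
      apply/seteqP; split => [x|_ [[x p] [Kxp Fp] <-] /= Cx]; last first.
        by have [j jk Vp] := Cx p Kxp; exact: (Fp j).
      move=> /existsNP[p /not_implyP[Kxp nV]]; exists (x, p) => //; split => //.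
      by move=> j jk Vp; apply: nV; exists j.
    apply: analytic_image => //; apply: analyticI_closed => //.
    apply: closed_comp => [? _|]; first exact: csnd.
    by apply: closed_bigI => j _; apply: open_closedC; exact: open_interior.
  - move=> x _; have := cK x; rewrite compact_cover => /(_ nat setT (V m)) [].
    + by move=> j _; exact: open_interior.
    + by move=> p _; have [j Vp] := V_cover m p; exists j.
    move=> s _ sV; exists (\max_(j <- finmap.enum_fset s) j)%N.+1 => // p /sV[j js Vp]; exists j => //.
    by rewrite ltnS; exact: (@leq_bigmax_seq _ (finmap.enum_fset s) xpredT id j js).
pose U n := if unpickle n is Some (m, j) then V m j else set0.
have oU n : open (U n).
  rewrite /U; case: (unpickle n) => [[m j]|]; last exact: open0.
  exact: open_interior.
have baseU p O : nbhs p O -> exists n, U n p /\ U n `<=` O.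
  move=> /closed_base[m [j [Vp VO]]]; exists (pickle (m, j)).
  rewrite /U pickleK; split => //.
  by apply: subset_trans VO; exact: subset_closure.
pose Y n := [set x | forall p, U n p -> ~ K (x, p)].
have aYC n : analytic (~` Y n).
  have -> : ~` Y n = fst @` (K `&` (setT `*` U n)).
    apply/seteqP; split => [x|_ [[x p] [Kxp [_ Up]] <-] /= Yx]; last exact: (Yx p).
    by move=> /existsNP[p /not_implyP[Up /contrapT Kxp]]; exists (x, p).
  apply: analytic_image => //; apply: analyticI => //.
  by apply: analyticX => //; exact: (oP (oU n)).1.
(* Sections of [K] are closed, so a point outside [K] lies in a rectangle with sides [Y n] and [U n]
   that misses [K]. These rectangles are coanalytic and are refined to bianalytic sets [E n]. *)
have [||E [bE EC KE]] := coanalytic_cover sXP sepXP (C := fun n => Y n `*` U n) aKC.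
- move=> n; have -> : ~` (Y n `*` U n) = (~` Y n `*` setT) `|` (setT `*` ~` U n).
    apply/seteqP; split => [[x y] /= /not_andP[]|[x y] /= [[nA _] [/nA//]|[_ nB] [_ /nB//]]].
      by left.
    by right.
  by apply: analyticU; apply: analyticX => //; exact: (oP (oU n)).2.
- move=> [x p] nK; have : nbhs p (~` [set p | K (x, p)]).
    apply: open_nbhs_nbhs; split => //; apply: closed_openC.
    exact: compact_closed (cK x).
  by move=> /baseU[n [Up UK]]; exists n => //; split => // r /UK.
(* The projection of [E n] is only analytic and [Y n] only coanalytic; a bianalytic [B n] is
   inserted between them. *)
have /choice[B BP] n : exists B, [/\ bianalytic B, fst @` E n `<=` B & B `<=` Y n].
  have [|||B [bB BY EB]] := @coanalytic_cover _ _ sX sepX (fst @` E n) (fun=> Y n).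
  - by apply: analytic_image => //; exact: (bE n).1.
  - by move=> _; exact: aYC.
  - by move=> _ [[x p] /EC[Yx _] <-]; exists 0%N.
  exists (\bigcup_k B k); split => //; first exact: bianalytic_bigcup.
  by move=> x [k _]; exact: BY.
pose cell M (j : nat -> nat) := [set p | forall m, (m < M)%N -> V m (j m) p].
have cell_agree M j j' : agree M j j' -> cell M j = cell M j'.
  move=> jj'; apply/seteqP; split => p h m mM; first by rewrite -jj'//; exact: h.
  by rewrite jj'//; exact: h.
(* Goodness certifies that the cell contains no point of the section: it is empty, or it lies in
   some [U n] that [B n] guarantees to miss the section. *)
pose good M j := [set x | cell M j = set0 \/
  exists2 n, (n < M)%N & B n x /\ cell M j `<=` U n].
(* [M] is a level of the tree and [k] lists the branching bounds below it. Given the sets [D], every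
   point of the section lies in a cell with indices under these bounds, so goodness of those cells
   leaves the section empty. *)
have fstKE : ~` (fst @` K) = \bigcup_M \bigcup_(k : seq nat)
    ((\bigcap_(m in `I_M) D m (nth 0%N k m)) `&`
     \bigcap_(s in [set s : seq nat | forall m, (m < M)%N -> (nth 0 s m < nth 0 k m)%N])
       good M (nth 0%N s)).
  apply/seteqP; split => [x nKx|x [M _ [k _ [Dx gx]]] [[x' p] Kxp /= xE]]; last first.
    rewrite {x'}xE in Kxp.
    have /choice[j jP] m : exists j, (m < M)%N -> (j < nth 0 k m)%N /\ V m j p.
      have [mM|] := ltnP m M; last by exists 0%N.
      by have [_ /(_ (nth 0%N k m) x (Dx m mM) p Kxp)[j ? ?] _] := DP m; exists j.
    have pc : cell M (nth 0%N (mkseq j M)) p.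
      by move=> m mM; rewrite nth_mkseq//; exact: (jP m mM).2.
    have [m mM|c0|[n nM [Bx cU]]] := gx (mkseq j M).
    - by rewrite nth_mkseq//; exact: (jP m mM).1.
    - by move: pc; rewrite c0.
    - by have [_ _ /(_ x Bx p (cU p pc))] := BP n.
  have /choice[k kP] m : exists k, D m k x.
    by have [_ _ /(_ x I)[k _ ?]] := DP m; exists k.
  apply: contrapT => nx.
  pose bad M j := [/\ forall m, (m < M)%N -> (j m < k m)%N & ~ good M j x].
  have badS M M' j : (M <= M')%N -> bad M' j -> bad M j.
    move=> MM' [jk nb]; split => [m mM|gM]; first by apply: jk; exact: leq_trans MM'.
    have cc : cell M' j `<=` cell M j.
      by move=> p cp m mM; apply: cp; exact: leq_trans MM'.
    apply: nb; case: gM => [c0|[n nM [Bx cU]]]; [left|right].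
      by apply/seteqP; split => // p /cc; rewrite c0.
    exists n; first exact: leq_trans MM'.
    by split => //; exact: subset_trans cU.
  have bad_agree M j j' : agree M j j' -> bad M j -> bad M j'.
    move=> jj' [jk nb]; split => [m mM|]; first by rewrite -jj'//; exact: jk.
    by rewrite /good /= -(cell_agree _ _ _ jj').
  have ex_bad M : exists j, bad M j.
    apply: contrapT => nbad; apply: nx; exists M => //; exists (mkseq k M) => //.
    split => [m /= mM|s /= sk]; first by rewrite nth_mkseq//; exact: kP.
    apply: contrapT => ngood; apply: nbad; exists (nth 0%N s); split => // m mM.
    by have := sk m mM; rewrite nth_mkseq.
  (* The invariant of Koenig's lemma: the initial segment extends to bad branches of every depth. *)
  pose live M j := forall M', (M <= M')%N -> exists2 j', agree M j j' & bad M' j'.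
  have [|||j jlive] := @dependent_choice_upd _ live (fun=> 0%N).
  - move=> n w w' ww' lw M' nM'; have [j' wj' bj'] := lw M' nM'.
    by exists j' => //; exact: agree_trans (agree_sym ww') wj'.
  - by move=> M' _; have [j bj] := ex_bad M'; exists j.
  - move=> M j lj; apply: contrapT => /forallNP nl.
    (* If no child is live, each child [s] dies by some depth [N s]. Only children below [k M] can
       be bad, so the maximum of finitely many depths bounds the subtree, against liveness. *)
    have /choice[N NP] s : exists N, (M < N)%N /\
        forall j', agree M.+1 (upd M j s) j' -> ~ bad N j'.
      have /existsNP[N /not_implyP[MN nN]] := nl s; exists N; split => // j' aj' bj'.
      by apply: nN; exists j'.
    have [j' aj' bj'] := 
      lj _ (leq_trans (leqnSn M) (leq_maxl M.+1 (\max_(s < k M) N s)%N)).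
    have j'k : (j' M < k M)%N by apply: bj'.1; rewrite leq_max ltnSn.
    have [_ nb] := NP (j' M); apply: (nb j').
      by have := upd_agree (j' M) aj'; rewrite upd_id.
    apply: badS bj'; rewrite leq_max; apply/orP; right.
    exact: (@leq_bigmax _ (fun s : 'I_(k M) => N s) (Ordinal j'k)).
  have jbad M : bad M j.
    by have [j' jj'] := jlive M M (leqnn M); apply: bad_agree; exact: agree_sym.
  (* The cells along an infinite bad branch shrink to a point [p]. As [x] is not in the projection,
     [p] lies in some [U n] with [x] in [B n], and a late cell inside [U n] is good. *)
  have [||M|p pP] := @shrinking_cvg e (a \o j) (fun m => V m (j m)).
  - exact: e_small.
  - by move=> m; exact: V_ball.
  - apply: contrapT => /forallNP c0; have [_] := jbad M; apply; left.
    by apply/seteqP; split => // y /c0.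
  have [n _ Exp] : (\bigcup_n E n) (x, p).
    by apply: KE => Kxp; apply: nKx; exists (x, p).
  have [_ Up] := EC n _ Exp.
  have [M cM] : exists M, forall y, (forall m, (m < M)%N -> V m (j m) y) -> U n y.
    by apply: pP; exact: open_nbhs_nbhs.
  have [_] := jbad (maxn M n.+1); apply; right; exists n; first exact: leq_maxr.
  split; first by have [_ + _] := BP n; apply; exists (x, p).
  move=> y cy; apply: cM => m mM; apply: cy; exact: leq_trans (leq_maxl _ _).
(* Taking the bianalytic sets as the measurable sets of a type gives access to the closure lemmas
   for countable unions and intersections. *)
pose MX := g_sigma_algebraType (@bianalytic X).
have mE (A : set MX) : measurable A = bianalytic A.
  by rewrite /measurable /= sigma_algebra_id.
rewrite -(setCK (fst @` K)) fstKE; apply: bianalyticC; rewrite -mE.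
apply: bigcupT_measurable => M; apply: countable_bigcupT_measurable => // k.
apply: measurableI.
  by apply: fin_bigcap_measurable => // m _; rewrite mE; have [] := DP m.
have mg s : @measurable _ MX (good M s).
  have -> : good M s = [set x | cell M s = set0] `|`
      \bigcup_(n in [set n | (n < M)%N /\ cell M s `<=` U n]) B n.
    apply/seteqP; split => x [h|]; [by left| |by left|].
      by move=> [n nM [Bx cU]]; right; exists n.
    by move=> [n [nM cU] Bx]; right; exists n.
  apply: measurableU.
    have [->|c0] := pselect (cell M s = set0).
      by rewrite (_ : [set _ | _] = setT)//; apply/seteqP; split.
    by rewrite (_ : [set _ | _] = set0)//; apply/seteqP; split.
  by apply: bigcup_measurable => n _; rewrite mE; have [] := BP n.
set G := [set s | _]; rewrite -(setCK (\bigcap_(s in G) _)) setC_bigcap.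
apply: measurableC; rewrite bigcup_mkcond; apply: countable_bigcupT_measurable => // s.
by case: ifP => // _; apply: measurableC; exact: mg.
Qed.

End projection.
End polish.

(** Injectivity turns the image of a complement into a difference inside the range, so the sets with
    bianalytic image form a sigma-algebra. *)
Lemma bianalytic_injective_image (T U : topologicalType) (f : T -> U)
    (G : set (set T)) : hausdorff_space U -> injective f ->
  bianalytic (range f) -> (forall B, G B -> bianalytic (f @` B)) ->
  forall B, <<s G>> B -> bianalytic (f @` B).
Proof.
move=> hU injf bf GB; apply: smallest_sub => //; split => /=.
- by rewrite image_set0; split; [exact: analytic0|rewrite setC0 -(setvU (range f)); apply: analyticU; case: bf].
- move=> B [aB aBC]; have fBC : f @` (setT `\` B) = range f `&` ~` (f @` B).
    apply/seteqP; split => [_ [x [_ nB] <-]|_ [[x _ <-] nfB]].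
      by split; [exists x|move=> [y By /injf yx]; apply: nB; rewrite -yx].
    by exists x => //; split => // Bx; apply: nfB; exists x.
  rewrite fBC; split; first by apply: analyticI => //; case: bf.
  by rewrite setCI setCK; apply: analyticU => //; case: bf.
- by move=> B bB; rewrite image_bigcup; exact: bianalytic_bigcup.
Qed.

Lemma dense_sequence (T : ptopologicalType) (D : set T) : countable D ->
  dense D -> exists a : nat -> T, forall O, O !=set0 -> open O -> exists j, O (a j).
Proof.
move=> /countable_injP[f injf] dD.
exists (fun j => xget point [set x | D x /\ f x = j]) => O O0 oO.
have [x [Ox Dx]] := dD O O0 oO; exists (f x).
case: xgetP => [y -> [Dy /injf yx]|/(_ x)[]//].
by rewrite yx ?inE.
Qed.

Lemma polish_facts (R : realType) (T : topologicalType) :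
  borel_subset_of_polish R T ->
  [/\ hausdorff_space T, analytic [set: T] & <<s @open T>> `<=` @bianalytic T].
Proof.
move=> [P [i [hP [D cD dD] inji emb bi]]].
have [a aD] := dense_sequence cD dD.
have ci : continuous i.
  by apply/continuousP => V oV; apply/emb; exists V.
have hT : hausdorff_space T.
  move=> x y cl; apply: inji; apply: hP => U V /ci xU /ci yV.
  by have [z [? ?]] := cl _ _ xU yV; exists (i z).
have aT : analytic [set: T].
  apply: (analytic_embedding inji); first by move=> V /emb.
  exact: (polish_borel_bianalytic hP aD bi).1.
split => //; apply: borel_bianalytic => // O /emb[V /(open_Fsigma aD)[F [cF ->]] ->].
exists (fun n => i @^-1` F n); split; last by rewrite preimage_bigcup.
by move=> n; apply: preimage_closed => // x _; exact: ci.
Qed.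

Lemma compact_bigcap_nonempty (T : topologicalType) (C : (set T)^nat) :
  hausdorff_space T -> (forall n, compact (C n)) ->
  (forall n, C n !=set0) -> (forall n, C n.+1 `<=` C n) ->
  \bigcap_n C n !=set0.
Proof.
move=> hT cC /choice[y Cy] decC.
have decC' n m : (n <= m)%N -> C m `<=` C n.
  by move=> /subnK <-; elim: (m - n)%N => // k ih; apply: subset_trans ih; exact: decC.
have [|p [C0p clp]] := cC 0%N (y @ \oo) _.
  by exists 0%N => // n _; exact: decC' (Cy n).
exists p => n _; have := compact_closed hT (cC n); apply => B /(clp (C n)).
by apply; exists n => // m /= nm; exact: decC' nm _ (Cy m).
Qed.

(** * Measurable selection from compact sections *)

Section measurable_selection.
Context {R : realType} {X A : ptopologicalType}.
Hypotheses (polishX : borel_subset_of_polish R X)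
           (polishA : borel_subset_of_polish R A).

(** The projection theorem asks for a complete second factor, so [K] is carried into [X * P] by the
    embedding of [A]. Injectivity keeps the image bianalytic, continuity keeps its sections compact,
    and Souslin's theorem makes the bianalytic projection Borel. *)
Lemma measurable_projection (K : set (borel X * borel A)) : measurable K ->
  (forall x, compact [set a : A | K (x, a)]) -> measurable (fst @` K : set (borel X)).
Proof.
have [hX aX bX] := polish_facts polishX.
have [P [i [hP [D cD dD] inji emb bi]]] := polishA.
have [d dP] := dense_sequence cD dD.
have bP := polish_borel_bianalytic hP dP.
have aP := analytic_polish dP.
have ci : continuous i by apply/continuousP => V oV; apply/emb; exists V.
move=> mK cK.
pose f (xa : X * A) : X * P := (xa.1, i xa.2).
have injf : injective f by move=> [x a] [y b] [-> /inji ->].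
have bT (Y : topologicalType) : analytic [set: Y] -> bianalytic [set: Y].
  by move=> aY; split => //; rewrite setCT; exact: analytic0.
have biB (B : set A) : <<s @open A>> B -> bianalytic (i @` B).
  apply: bianalytic_injective_image => // [|O /emb[V oV ->]]; first exact: bP.
  have -> : i @` (i @^-1` V) = V `&` range i.
    apply/seteqP; split => [_ [x Vx <-]|p [Vp [x _ xp]]]; first by split => //; exists x.
    by exists x; rewrite /= ?xp.
  have bV : bianalytic V by apply: bP; exact: sub_sigma_algebra.
  have bri := bP _ bi.
  split; first by apply: analyticI => //; [exact: bV.1|exact: bri.1].
  by rewrite setCI; apply: analyticU; [exact: bV.2|exact: bri.2].
have bfK : bianalytic (f @` (K : set (X * A))).
  have hXP := hausdorff_prod hX hP.
  have fX (B : set X) (C : set A) : f @` (B `*` C) = B `*` (i @` C).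
    apply/seteqP; split => [_ [[x a] [/= Bx Ca] <-]|[x p] [/= Bx [a Ca <-]]].
      by split => //; exists a.
    by exists (x, a).
  move: mK; rewrite measurable_prod_measurableType.
  apply: bianalytic_injective_image => //.
    by rewrite -setXTT fX; apply: bianalyticX => //; [exact: bT|exact: bP].
  move=> _ [B mB [C mC <-]]; rewrite fX; apply: bianalyticX => //; first exact: bX.
  exact: biB.
have cfK x : compact [set p | (f @` (K : set (X * A))) (x, p)].
  have -> : [set p | (f @` (K : set (X * A))) (x, p)] = i @` [set a : A | K (x, a)].
    apply/seteqP; split => [p [[y a] Ka [yx ip]]|_ [a Ka <-]].
      by exists a; rewrite // -yx.
    by exists (x, a).
  apply: continuous_compact (cK x); exact: continuous_subspaceT.
have fstE : fst @` K = fst @` (f @` (K : set (X * A))).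
  apply/seteqP; split => [_ [[x a] Ka <-]|_ [_ [[x a] Ka <-] <-]]; last by exists (x, a).
  by exists (f (x, a)) => //; exists (x, a).
have oX (O : set X) : open O -> bianalytic O.
  by move=> oO; apply: bX; exact: sub_sigma_algebra.
have := bianalytic_projection hP dP hX aX oX bfK cfK; rewrite -fstE.
apply: bianalytic_in_sigma_algebra; first exact: smallest_sigma_algebra.
move=> x y /(hausdorff_separate hX)[U [V [xU yV UV]]]; exists U, V.
by split => //; [apply: sub_sigma_algebra xU.1|exact: sub_sigma_algebra yV.1|
  exact: open_nbhs_nbhs..].
Qed.

Let selectable (K : set (borel X * borel A)) :=
  [/\ measurable K, forall x, compact [set a : A | K (x, a)] &
      forall x, [set a : A | K (x, a)] !=set0].

Lemma measurable_section_hit (K : set (borel X * borel A)) (F : set A) :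
  measurable K -> (forall x, compact [set a : A | K (x, a)]) -> closed F ->
  measurable (fst @` (K `&` (setT `*` F)) : set (borel X)).
Proof.
move=> mK cK cF; apply: measurable_projection.
  apply: measurableI => //; apply: measurableX => //.
  by rewrite -(setCK F); apply: measurableC; apply: sub_sigma_algebra; exact: closed_openC.
move=> x; have [hA _ _] := polish_facts polishA.
apply: (@subclosed_compact _ _ [set a : A | K (x, a)]) => //.
  have -> : [set a | (K `&` (setT `*` F)) (x, a)] = [set a : A | K (x, a)] `&` F.
    by apply/seteqP; split => [a [? []]//|a [? ?]]; split.
  by apply: closedI => //; exact: compact_closed (cK x).
by move=> a [].
Qed.

(** At stage m each section keeps only its part in the first closed ball of scale m that it meets.
    Sections stay compact and nonempty and shrink to the single point [phi x]; every cut is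
    measurable by [measurable_section_hit]. *)
Lemma measurable_uniformization (Z : set (borel X * borel A)) : measurable Z ->
  (forall x, compact [set a : A | Z (x, a)]) ->
  (forall x, [set a : A | Z (x, a)] !=set0) ->
  exists phi : borel X -> borel A,
    measurable_fun [set: borel X] phi /\ forall x, Z (x, phi x).
Proof.
move=> mK0 cK0 K00.
have [hA _ _] := polish_facts polishA.
have [P [i [hP [D cD dD] inji emb bi]]] := polishA.
have [d dP] := dense_sequence cD dD.
have ci : continuous i by apply/continuousP => V oV; apply/emb; exists V.
pose e m : R := m.+1%:R^-1%R.
have e0 m : (0 < e m)%R by rewrite invr_gt0.
pose F m j : set A := i @^-1` closure (ball (d j) (e m)).
have cF m j : closed (F m j).
  by apply: preimage_closed => [x _|]; [exact: ci|exact: closed_closure].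
have F_cover m a : exists j, F m j a.
  have [j dj] : exists j, (ball (i a) (e m))° (d j).
    apply: dP (@open_interior _ _); exists (i a).
    exact: (@open_nbhs_ball _ _ (i a) (PosNum (e0 m))).2.
  by exists j; apply: subset_closure; apply: ball_sym; exact: interior_subset dj.
have step m K : selectable K -> exists K', [/\ selectable K', K' `<=` K &
    forall x, exists j, forall a, K' (x, a) -> F m j a].
  move=> [mK cK K0]; pose H j : set (borel X) := fst @` (K `&` (setT `*` F m j)).
  have mH j : measurable (H j) by exact: measurable_section_hit.
  pose N j := H j `\` \bigcup_(k in `I_j) H k.
  have mN j : measurable (N j).
    by apply: measurableD => //; apply: fin_bigcup_measurable.
  have HE j x : H j x <-> exists2 a, K (x, a) & F m j a.
    split => [[[y a] [Kya [_ Fa]] /= yx]|[a Ka Fa]]; first by rewrite -yx; exists a.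
    by exists (x, a).
  have exN x : exists j, N j x.
    have [a Ka] := K0 x; have [j0 Fa] := F_cover m a.
    have ex : exists j, `[< H j x >] by exists j0; apply/asboolP/HE; exists a.
    have [j /asboolP Hj jmin] := ex_minnP ex; exists j; split => // -[k /= kj Hk].
    by have := jmin k (asboolT Hk); rewrite leqNgt [(k < j)%N]kj.
  have uniN x j k : N j x -> N k x -> j = k.
    move=> [Hj nj] [Hk nk]; apply/eqP; rewrite eqn_leq.
    by apply/andP; split; rewrite leqNgt; apply/negP => jk; [apply: nj; exists k|apply: nk; exists j].
  pose K' := \bigcup_j (K `&` (N j `*` F m j)).
  have K'E x j a : N j x -> K' (x, a) <-> K (x, a) /\ F m j a.
    move=> Nj; split => [[k _ [Ka [/= Nk Fa]]]|[Ka Fa]]; last by exists j.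
    by rewrite (uniN _ _ _ Nj Nk).
  exists K'; split.
  - split.
    + apply: bigcupT_measurable => j; apply: measurableI => //; apply: measurableX => //.
      rewrite -(setCK (F m j)); apply: measurableC; apply: sub_sigma_algebra.
      exact: closed_openC.
    + move=> x; have [j Nj] := exN x.
      have -> : [set a : A | K' (x, a)] = [set a : A | K (x, a)] `&` F m j.
        by apply/seteqP; split => a /= /(K'E _ _ _ Nj).
      apply: (@subclosed_compact _ _ [set a : A | K (x, a)]) => //.
      by apply: closedI => //; exact: compact_closed (cK x).
    + move=> x; have [j Nj] := exN x; have [/HE[a Ka Fa] _] := Nj.
      by exists a; apply/(K'E _ _ _ Nj).
  - by move=> xa [j _ []].
  - move=> x; have [j Nj] := exN x; exists j => a.
    by move=> /(K'E _ _ _ Nj)[].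
have /choice[st stP] : forall mK : nat * set (borel X * borel A),
    exists K' : set (borel X * borel A),
    selectable mK.2 -> [/\ selectable K', K' `<=` mK.2 &
    forall x, exists j, forall a, K' (x, a) -> F mK.1 j a].
  move=> [m K]; have [/(step m)[K' ?]|ns] := pselect (selectable K); first by exists K'.
  by exists K.
pose Ks := fix Ks n := if n is m.+1 then st (m, Ks m) else Z.
have sK n : selectable (Ks n).
  by elim: n => [|n ih]; [split|have [] := stP (n, Ks n) ih].
have Ksub n : Ks n.+1 `<=` Ks n by have [] := stP (n, Ks n) (sK n).
have KF n x : exists j, forall a, Ks n.+1 (x, a) -> F n j a.
  by have [_ _] := stP (n, Ks n) (sK n); exact.
have /choice[phi phiP] x : exists a : A, forall n, Ks n (x, a).
  have [||||a aP] := @compact_bigcap_nonempty A (fun n => [set a : A | Ks n (x, a)]).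
  - exact: hA.
  - by move=> n; have [_ + _] := sK n; exact.
  - by move=> n; have [_ _] := sK n; exact.
  - by move=> n a; exact: Ksub.
  by exists a => n; exact: (aP n I).
have uniq x a b : (forall n, Ks n (x, a)) -> (forall n, Ks n (x, b)) -> a = b.
  move=> Ka Kb; apply: inji; apply: hP => U W /nbhs_ballP[eps /= eps0 aU] bW.
  exists (i b); split; last exact: nbhs_singleton bW.
  (* Both [a] and [b] lie within twice [e m] of a common centre, hence the quarter. *)
  have [m em] : exists m, (e m < eps / 4)%R.
    have eps4 : (0 < eps / 4)%R by rewrite divr_gt0.
    have [m _ /(_ m (leqnn m))] := near_infty_natSinv_lt (PosNum eps4).
    by exists m.
  have [j Fj] := KF m x; apply: aU.
  have := ball_triangle (ball_sym (closure_ball_subset (e0 m) (Fj a (Ka m.+1))))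
    (closure_ball_subset (e0 m) (Fj b (Kb m.+1))).
  by apply: le_ball; move: em; lra.
exists phi; split; last by move=> x; exact: (phiP x 0%N).
apply: (@measurability _ _ (borel X) (borel A) setT phi (@open A)) => //.
move=> _ [U oU <-]; rewrite setTI.
(* By compactness, if every shrunken section met the complement of [U], so would their intersection,
   which is the point [phi x]. *)
have -> : phi @^-1` U = ~` \bigcap_n fst @` (Ks n `&` (setT `*` ~` U)).
  apply/seteqP; split => [x Ux h|x]; last first.
    move=> h; apply: contrapT => nU; apply: h => n _.
    by exists (x, phi x).
  have [||||a aP] := @compact_bigcap_nonempty A
      (fun n => [set a : A | Ks n (x, a)] `&` ~` U).
  - exact: hA.
  - move=> n; have [_ cn _] := sK n.
    apply: (@subclosed_compact _ _ [set a : A | Ks n (x, a)]) => //.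
    apply: closedI; first exact: compact_closed (cn x).
    exact: open_closedC.
  - by move=> n; have [[y a] [Ka [_ nU]] /= yx] := h n I; exists a; rewrite -yx.
  - by move=> n a [Ka nU]; split => //; exact: Ksub.
  have xa : phi x = a.
    by apply: (uniq x) => [n|n]; [exact: phiP|exact: (aP n I).1].
  by have [_ +] := aP 0%N I; apply; rewrite -xa.
apply: measurableC; apply: bigcapT_measurable => n; have [mn cn _] := sK n.
by apply: measurable_section_hit => //; exact: open_closedC.
Qed.

End measurable_selection.

(** * The Ionescu Tulcea theorem *)

Section kernel_precomposition.
Context d d' d2 (X : measurableType d) (Y : measurableType d')
  (Z : measurableType d2) (R : realType).
Variables (f : X -> Y) (k : R.-pker Y ~> Z).

Definition kprecomp (mf : measurable_fun [set: X] f) (x : X) :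
  {measure set Z -> \bar R} := k (f x).

Hypothesis mf : measurable_fun [set: X] f.

Let kprecomp_measurable U : measurable U ->
  measurable_fun [set: X] (kprecomp mf ^~ U).
Proof.
move=> mU.
exact: (measurableT_comp (measurable_kernel k U mU) mf).
Qed.

HB.instance Definition _ := isKernel.Build _ _ _ _ _ (kprecomp mf)
  kprecomp_measurable.

Let kprecomp_prob x : kprecomp mf x [set: Z] = 1.
Proof. exact: prob_kernel. Qed.

HB.instance Definition _ := Kernel_isProbability.Build _ _ _ _ _
  (kprecomp mf) kprecomp_prob.

End kernel_precomposition.

Section probability_kernel_composition.
Context d d' d2 (X : measurableType d) (Y : measurableType d')
  (Z : measurableType d2) (R : realType).
Variables (l : R.-pker X ~> Y) (k : R.-pker (X * Y) ~> Z).

Definition pkcomp (x : X) : {measure set Z -> \bar R} := (l \; k) x.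

Let pkcomp_measurable U : measurable U -> measurable_fun [set: X] (pkcomp ^~ U).
Proof. exact: measurable_fun_mkcomp_sfinite. Qed.

HB.instance Definition _ := isKernel.Build _ _ _ _ _ pkcomp pkcomp_measurable.

Let pkcomp_prob x : pkcomp x [set: Z] = 1.
Proof.
rewrite /pkcomp /= /kcomp (eq_integral (cst 1)).
  by rewrite integral_cst// mul1e prob_kernel.
by move=> y _; rewrite prob_kernel.
Qed.

HB.instance Definition _ := Kernel_isProbability.Build _ _ _ _ _
  pkcomp pkcomp_prob.

Lemma integral_pkcomp x f : (forall z, 0 <= f z) -> measurable_fun [set: Z] f ->
  \int[pkcomp x]_z f z = \int[l x]_y (\int[k (x, y)]_z f z).
Proof. exact: integral_kcomp. Qed.

End probability_kernel_composition.

Section ionescu_tulcea.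
Context d (S : measurableType d) (R : realType).

(** For state-action pairs this is convertible to [cylinder], so that results on [seqspace] transfer
    to [trajectory] by conversion. *)
Definition coordinate_cylinder : set (set (nat -> S)) :=
  [set C | exists (t : nat) (F : set S), measurable F /\ C = [set w | F (w t)]].

Definition seqspace : Type := g_sigma_algebraType coordinate_cylinder.
HB.instance Definition _ := Measurable.on seqspace.

Local Notation Om := seqspace.

Lemma measurable_coordinate t : measurable_fun [set: Om] (fun w : Om => w t).
Proof.
move=> _ F mF; rewrite setTI; apply: sub_sigma_algebra; exists t, F; split => //.
Qed.

Lemma measurable_seqspaceP d' (T : measurableType d') (f : T -> Om) :
  (forall t, measurable_fun [set: T] (fun x => f x t)) ->
  measurable_fun [set: T] f.
Proof.
move=> mf; apply: (@measurability _ _ T Om setT f coordinate_cylinder) => //.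
move=> _ [_ [t [F [mF ->]]] <-].
exact: (mf t measurableT F mF).
Qed.

Lemma measurable_upd t : measurable_fun [set: Om * S] (fun ws : Om * S => upd t ws.1 ws.2 : Om).
Proof.
apply: measurable_seqspaceP => i; rewrite /upd; case: eqP => _.
  exact: measurable_snd.
exact: (measurableT_comp (measurable_coordinate i) measurable_fst).
Qed.

Lemma measurable_upd_new t (w : Om) : measurable_fun [set: S] (fun s => upd t w s : Om).
Proof. by apply: measurable_seqspaceP => i; rewrite /upd; case: eqP. Qed.

Variable k : nat -> R.-pker Om ~> S.

(** Kernels act on whole sequences and resample a single coordinate, which avoids history types
    indexed by time; that [k t] reads only the past is the later hypothesis [k_agree]. *)
Definition kstep t : R.-pker Om ~> Om := pkcomp (k t) (kdirac (measurable_upd t)).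

Lemma integral_kstep t w f : (forall w', 0 <= f w') -> measurable_fun [set: Om] f ->
  \int[kstep t w]_w' f w' = \int[k t w]_s f (upd t w s).
Proof.
move=> f0 mf; rewrite integral_pkcomp//; apply: eq_integral => s _.
by rewrite integral_dirac// diracT mul1e.
Qed.

Fixpoint ksteps t n : R.-pker Om ~> Om :=
  if n is m.+1 then pkcomp (kstep t) (kprecomp (ksteps t.+1 m) measurable_snd)
  else kdirac (@measurable_id _ Om setT).

Lemma kstepsS t n w (C : set Om) : measurable C ->
  ksteps t n.+1 w C = \int[k t w]_s ksteps t.+1 n (upd t w s) C.
Proof.
move=> mC; rewrite -(@integral_kstep t w (fun w' => ksteps t.+1 n w' C))//.
exact: measurable_kernel.
Qed.

Lemma dep_indic n (C : set Om) : dep n C -> dep n (fun w => (\1_C w : R)).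
Proof.
move=> dC w w' /dC ww'; rewrite !indicE.
have -> // : (w \in C) = (w' \in C).
by apply/idP/idP; rewrite !inE ww'.
Qed.

Lemma ksteps_dirac t n w (C : set Om) : measurable C -> dep t C ->
  ksteps t n w C = (\1_C w)%:E.
Proof.
move=> mC; elim: n t w => [|n ih] t w dC; first by rewrite /= /kdirac/= diracE indicE.
rewrite kstepsS// (eq_integral (cst (\1_C w)%:E)).
  by rewrite integral_cst// prob_kernel mule1.
move=> s _; rewrite ih; last exact: depW dC.
by congr EFin; apply/esym/(dep_indic dC); exact: agree_upd.
Qed.

Hypothesis k_agree : forall t w w', agree t w w' ->
  forall U, measurable U -> k t w U = k t w' U.

Lemma ksteps_agree t n w w' (C : set Om) : measurable C -> dep (t + n) C -> agree t w w' ->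
  ksteps t n w C = ksteps t n w' C.
Proof.
move=> mC; elim: n t w w' => [|n ih] t w w' dC ww'.
  rewrite addn0 in dC; rewrite !ksteps_dirac//; congr EFin.
  exact: (dep_indic dC).
rewrite !kstepsS// (eq_measure_integral (k t w')); last first.
  by move=> U mU _; exact: k_agree.
apply: eq_integral => s _; apply: ih; first by rewrite addSnnS.
exact: upd_agree.
Qed.

(** Consistency of the finite-dimensional laws: coordinates from [t + n] on do not affect membership
    in [C], so resampling them changes nothing. *)
Lemma ksteps_stable t n m w (C : set Om) : measurable C -> dep (t + n) C -> (n <= m)%N ->
  ksteps t m w C = ksteps t n w C.
Proof.
move=> mC; elim: n t m w => [|n ih] t m w dC nm.
  by rewrite addn0 in dC; rewrite !ksteps_dirac.
case: m nm => // m; rewrite ltnS => nm; rewrite !kstepsS//.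
by apply: eq_integral => s _; apply: ih; rewrite // addSnnS.
Qed.

Lemma measurable_kint t (f : Om -> \bar R) : (forall w, 0 <= f w) ->
  measurable_fun [set: Om] f ->
  measurable_fun [set: Om] (fun w => \int[k t w]_s f (upd t w s)).
Proof.
move=> f0 mf.
apply: (measurable_fun_integral_finite_kernel (fun ws : Om * S => f (upd t ws.1 ws.2))) => //.
exact: (measurableT_comp mf (measurable_upd t)).
Qed.

(** [ksteps] unfolds from its first step, which suits conditioning on an initial segment; the
    one-step identity of the final theorem needs the last step isolated instead. *)
Lemma integral_kstepsS t n w f : (forall w', 0 <= f w') ->
  measurable_fun [set: Om] f ->
  \int[ksteps t n.+1 w]_w' f w' =
  \int[ksteps t n w]_w' \int[k (t + n)%N w']_s f (upd (t + n) w' s).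
Proof.
move=> f0 mf; elim: n t w => [|n ih] t w.
  rewrite integral_pkcomp//=; under eq_integral do
    rewrite /kprecomp /= /kdirac /= integral_dirac// diracT mul1e.
  rewrite integral_kstep// addn0 /kdirac/= integral_dirac//.
    by rewrite diracT mul1e.
  exact: measurable_kint.
rewrite [LHS]integral_pkcomp//= [RHS]integral_pkcomp//; last 2 first.
- by move=> w'; apply: integral_ge0.
- exact: measurable_kint.
by apply: eq_integral => w' _; rewrite [LHS]ih addSnnS.
Qed.

Variable w0 : Om.

(** A copy of the sequence space that carries only the algebra of sets determined by finitely many
    coordinates, as input for the Caratheodory extension. *)
Definition cylinder_algebra : Type := nat -> S.
HB.instance Definition _ := Pointed.on cylinder_algebra.

Let cyl : set (set cylinder_algebra) :=
  [set C | @measurable _ Om C /\ exists n, dep n C].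

Let cyl0 : cyl set0. Proof. by split => //; exists 0%N. Qed.

Let cylU : setU_closed cyl.
Proof.
move=> C D [mC [n dC]] [mD [m dD]]; split; first exact: measurableU.
exists (maxn n m) => w w' ww'; rewrite /setU /mkset.
rewrite (dC _ w') ?(dD _ w')//; apply: agreeW ww'; [exact: leq_maxr|exact: leq_maxl].
Qed.

Let cylC : setC_closed cyl.
Proof.
move=> C [mC [n dC]]; split; first exact: measurableC.
by exists n => w w' ww'; rewrite /setC /mkset (dC _ w').
Qed.

HB.instance Definition _ := isAlgebraOfSets.Build default_measure_display
  cylinder_algebra cyl0 cylU cylC.

(** By consistency every admissible [n] gives the same value; the default of [xget] arises only for
    sets outside the algebra. *)
Definition cylinder_measure (C : set cylinder_algebra) : \bar R :=
  ksteps 0 (xget 0%N [set n | dep n C]) w0 C.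

Lemma cylinder_measureE n (C : set cylinder_algebra) : @measurable _ Om C ->
  dep n C -> cylinder_measure C = ksteps 0 n w0 C.
Proof.
move=> mC dC; rewrite /cylinder_measure; case: xgetP => [m _ dmC|/(_ n)//].
have [nm|/ltnW mn] := leqP n m; first exact: ksteps_stable.
by apply/esym; exact: ksteps_stable.
Qed.

Lemma cylinder_measure_ge0 (C : set cylinder_algebra) : 0 <= cylinder_measure C.
Proof. exact: measure_ge0. Qed.

(* The Ionescu Tulcea argument: if the measures of the [G n] stay away from 0,
   the coordinates of a common point can be chosen one at a time so that the
   conditional measures of the [G n] stay away from 0. *)
Lemma cylinder_measure_continuous (G : (set Om)^nat) :
  (forall n, measurable (G n)) -> (forall n, exists m, dep m (G n)) ->
  (forall n, G n.+1 `<=` G n) -> \bigcap_n G n = set0 ->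
  cylinder_measure (G n) @[n --> \oo] --> 0.
Proof.
move=> mG /choice[r rG] dG G0.
(* The conditional measure of [G n] given the first t coordinates of [w]. The truncated difference
   is 0 once these coordinates decide [G n]. *)
pose Q t n w := ksteps t (r n - t) w (G n).
have rI t n : dep (t + (r n - t)) (G n) by apply: depW (rG n); lia.
have IE t n w m : (r n - t <= m)%N -> Q t n w = ksteps t m w (G n).
  by move=> rm; rewrite [RHS](ksteps_stable _ (mG n) (rI t n) rm).
have IS t n w : Q t n w = \int[k t w]_s Q t.+1 n (upd t w s).
  rewrite (IE t n w (r n - t).+1)// kstepsS//; apply: eq_integral => s _.
  by rewrite (IE t.+1 n _ (r n - t)%N)//; lia.
have Idec t w : nonincreasing_seq (fun n => Q t n w).
  apply/nonincreasing_seqP => n.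
  rewrite (IE t n w (maxn (r n) (r n.+1))); last by lia.
  rewrite (IE t n.+1 w (maxn (r n) (r n.+1))); last by lia.
  by apply: le_measure; rewrite ?inE//; exact: dG.
have I0 t n w : 0 <= Q t n w by exact: measure_ge0.
have I1 t n w : Q t n w <= 1.
  rewrite -(prob_kernel (s := ksteps t (r n - t)) w).
  by apply: le_measure; rewrite ?inE.
have mI t n : measurable_fun [set: Om] (Q t n) by exact: measurable_kernel.
pose J t w := ereal_inf (range (fun n => Q t n w)).
have J0 t w : 0 <= J t w by apply: le_ereal_inf_tmp => _ [n _ <-].
have IJ t w : Q t n w @[n --> \oo] --> J t w by exact: ereal_nonincreasing_cvgn.
(* Dominated convergence, with bound 1, makes the limit [J] at time t an average of its values at
   the next time, so a nonzero value has a nonzero successor. *)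
have JS t w : J t w = \int[k t w]_s J t.+1 (upd t w s).
  have mIu n : measurable_fun [set: S] (fun s => Q t.+1 n (upd t w s)).
    exact: (measurableT_comp (mI t.+1 n) (measurable_upd_new t w)).
  have [||||_ _ cv] := @dominated_convergence _ _ _ (k t w) setT measurableT
    (fun n s => Q t.+1 n (upd t w s)) (fun s => J t.+1 (upd t w s)) (cst 1) mIu.
  - apply: (@emeasurable_fun_cvg _ _ _ _ (fun n s => Q t.+1 n (upd t w s))).
      exact: mIu.
    by move=> s _; exact: IJ.
  - by apply/aeW => s _; exact: IJ.
  - apply/integrableP; split => //; rewrite (eq_integral (cst 1)).
      by rewrite integral_cst// prob_kernel mule1 ltry.
    by move=> s _; rewrite /= normr1.
  - by apply/aeW => s n _ /=; rewrite gee0_abs.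
  have := IJ t w; under eq_fun do rewrite IS.
  by move=> h; apply: (@cvg_unique _ (@ereal_hausdorff R) _ _ _ _ h cv).
have Jagree t w w' : agree t w w' -> J t w = J t w'.
  move=> ww'; rewrite /J; have -> // : (fun n => Q t n w) = (fun n => Q t n w').
  by apply/funext => n; exact: ksteps_agree.
under eq_fun do rewrite (cylinder_measureE (mG _) (rG _)).
suff J00 : J 0%N w0 = 0.
  have := IJ 0%N w0; rewrite J00; apply: cvg_trans; apply: near_eq_cvg.
  by near=> n; rewrite /Q subn0.
apply: contrapT => Jw0.
have [||t w|w wJ] := @dependent_choice_upd _ (fun t w => J t w <> 0) w0.
- by move=> t w w' /Jagree ->.
- by [].
- move=> Jtw; apply: contrapT => /forallNP nJ; apply: Jtw.
  by rewrite JS integral0_eq// => s _; have /contrapT := nJ s.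
suff : (\bigcap_n G n) w by rewrite G0.
(* At time [r n] the conditional measure of [G n] is its indicator at [w], and it dominates the
   nonzero [J]. *)
move=> n _; apply: contrapT => nG; apply: (wJ (r n)); apply/eqP.
rewrite eq_le J0 andbT; apply: (@le_trans _ _ (Q (r n) n w)).
  by apply: ereal_inf_lbound; exists n.
by rewrite /Q subnn ksteps_dirac// indicE memNset.
Unshelve. all: by end_near. Qed.

Let mu := cylinder_measure.

Let mu0 : mu set0 = 0. Proof. exact: measure0. Qed.

(** Finite additivity leaves the tails [G n] of the union, which decrease to the empty set;
    continuity there finishes. *)
Let mu_sigma_additive : semi_sigma_additive mu.
Proof.
move=> F mF tF mUF.
pose G n := \bigcup_i F i `\` \bigcup_(i < n) F i.
have cF n : measurable (\bigcup_(i < n) F i).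
  by apply: fin_bigcup_measurable.
have cG n : measurable (G n) by exact: measurableD.
have muD (C D : set cylinder_algebra) : measurable C -> measurable D ->
    C `&` D = set0 -> mu (C `|` D) = mu C + mu D.
  move=> [mC [n dC]] [mD [m dD]] CD; rewrite /mu.
  have dC' : dep (maxn n m) C by apply: depW dC; exact: leq_maxl.
  have dD' : dep (maxn n m) D by apply: depW dD; exact: leq_maxr.
  have dCD : dep (maxn n m) (C `|` D).
    by move=> w w' ww'; rewrite /setU /mkset (dC' _ _ ww') (dD' _ _ ww').
  rewrite (cylinder_measureE mC dC') (cylinder_measureE mD dD').
  rewrite (cylinder_measureE _ dCD); last exact: measurableU.
  exact: measureU.
have FG n : F n `|` G n.+1 = G n.
  rewrite /G bigcup_mkord big_ord_recr /= -bigcup_mkord.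
  apply/seteqP; split => [x [Fx|[[i _ Fx] nF]]|x [[i _ Fx] nF]].
  - split; first by exists n.
    move=> [i /= ni Fix]; have iE : i = n by apply: tF => //; exists x.
    by move: ni; rewrite iE ltnn.
  - by split; [exists i|move=> nF'; apply: nF; left].
  - have [Fnx|nFnx] := pselect (F n x); first by left.
    by right; split; [exists i|move=> [/nF|]].
have muFG n : mu (\bigcup_i F i) = \sum_(0 <= i < n) mu (F i) + mu (G n).
  elim: n => [|n ->].
    by rewrite big_nil add0e /G bigcup_mkord big_ord0 setD0.
  rewrite big_nat_recr//= -addeA -muD// ?FG//.
  apply/seteqP; split => // x [Fx [_ nF]]; apply: nF; exists n => //=.
have muG : mu (G n) @[n --> \oo] --> 0.
  apply: cylinder_measure_continuous.
  - by move=> n; have [] := cG n.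
  - by move=> n; have [] := cG n.
  - by move=> n; rewrite -(FG n); exact: subsetUr.
  - apply/seteqP; split => // x Gx; have [[i _ Fx] _] := Gx 0%N I.
    by have [_] := Gx i.+1 I; apply; exists i => /=.
have mufin (C : set cylinder_algebra) : measurable C -> mu C \is a fin_num.
  by move=> [mC _]; apply: finite_kernel_measure.
have -> : (fun n => \sum_(0 <= i < n) mu (F i)) = (fun n => mu (\bigcup_i F i) - mu (G n)).
  by apply/funext => n; rewrite (muFG n) addeK// mufin.
rewrite -[X in _ --> X]sube0; apply: cvgeB => //; first by rewrite fin_num_adde_defl.
  exact: cvg_cst.
Qed.

HB.instance Definition _ := isMeasure.Build _ _ _ cylinder_measure
  mu0 cylinder_measure_ge0 mu_sigma_additive.

Lemma measurable_cylinder_algebra (C : set Om) : measurable C ->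
  @measurable _ (g_sigma_algebraType (@measurable _ cylinder_algebra)) C.
Proof.
apply: smallest_sub; first exact: smallest_sigma_algebra.
move=> _ [t [F [mF ->]]]; apply: sub_sigma_algebra; split.
  by apply: sub_sigma_algebra; exists t, F.
by exists t.+1 => w w' /(_ t (ltnSn t)) wt; rewrite /mkset wt.
Qed.

Let extension (C : set Om) : \bar R :=
  measure_extension (cylinder_measure : {measure set cylinder_algebra -> \bar R}) C.

Let extension0 : extension set0 = 0. Proof. exact: measure0. Qed.

Let extension_ge0 C : 0 <= extension C. Proof. exact: measure_ge0. Qed.

Let extension_sigma_additive : semi_sigma_additive extension.
Proof.
move=> F mF tF mUF; apply: measure_semi_sigma_additive => // [i|].
  exact: measurable_cylinder_algebra.
exact: measurable_cylinder_algebra.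
Qed.

HB.instance Definition _ := isMeasure.Build _ _ _ extension
  extension0 extension_ge0 extension_sigma_additive.

Let extensionE n (C : set Om) : measurable C -> dep n C ->
  extension C = ksteps 0 n w0 C.
Proof.
move=> mC dC; rewrite -(cylinder_measureE mC dC).
by apply: measurable_mu_extE; split => //; exists n.
Qed.

Let extension_prob : extension setT = 1.
Proof. by rewrite (@extensionE 0%N)// prob_kernel. Qed.

HB.instance Definition _ := Measure_isProbability.Build _ _ _ extension
  extension_prob.

Lemma ionescu_tulcea : exists P : probability Om R,
  (forall f, (forall w, 0 <= f w) -> measurable_fun [set: Om] f -> dep 0 f ->
    \int[P]_w f w = f w0) /\
  (forall t f, (forall w, 0 <= f w) -> measurable_fun [set: Om] f ->
    dep t.+1 f -> \int[P]_w f w = \int[P]_w \int[k t w]_s f (upd t w s)).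
Proof.
exists extension.
(* A function of n coordinates factors through [trunc n], and preimages under [trunc n] depend on n
   coordinates; so the extension and the n-step kernel have the same image measure under it. *)
pose trunc n (w : Om) : Om := fun i => if (i < n)%N then w i else w0 i.
have trunc_agree n w : agree n (trunc n w) w by move=> i ni; rewrite /trunc ni.
have mtrunc n : measurable_fun [set: Om] (trunc n).
  apply: measurable_seqspaceP => i; rewrite /trunc; case: (i < n)%N => //.
  exact: measurable_coordinate.
have PE n f : (forall w, 0 <= f w) -> measurable_fun [set: Om] f -> dep n f ->
    \int[extension]_w f w = \int[ksteps 0 n w0]_w f w.
  move=> f0 mf df.
  have fE : f = f \o trunc n by apply/funext => w; exact/df/agree_sym.
  rewrite fE -[LHS](@ge0_integral_pushforward _ _ _ _ _ _ (mtrunc n) _ setT)//.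
  rewrite -[RHS](@ge0_integral_pushforward _ _ _ _ _ _ (mtrunc n) _ setT)//.
  apply: eq_measure_integral => C mC _; apply: extensionE.
    by rewrite -[X in measurable X]setTI; exact: mtrunc.
  move=> w w' ww'; rewrite /preimage /mkset.
  have -> // : trunc n w = trunc n w'.
  by apply/funext => i; rewrite /trunc; case: ifP => // /ww'.
split=> [f f0 mf df|t f f0 mf df].
  by rewrite (PE 0%N)// integral_dirac// diracT mul1e.
rewrite (PE t.+1)// integral_kstepsS// (PE t) ?add0n//.
- by move=> w; exact: integral_ge0.
- exact: measurable_kint.
- move=> w w' ww'; rewrite (eq_measure_integral (k t w')).
    by apply: eq_integral => s _; apply: df; exact: upd_agree.
  by move=> U mU _; exact: k_agree.
Qed.

End ionescu_tulcea.

(** * Existence of strategic measures *)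

Section strategic_measure_existence.
Context {R : realType} {X A : ptopologicalType}.
Variables (q : R.-pker (borel X * borel A) ~> borel X)
  (pi : policy (R := R) (X := X) (A := A)) (x : X).

Local Notation S := (borel X * borel A)%type.
Local Notation Om := (@trajectory X A).

Lemma measurable_trajectory_coordinate t :
  measurable_fun [set: Om] (fun w : Om => w t : S).
Proof. exact: (@measurable_coordinate _ S t). Qed.

Lemma ionescu_tulcea_trajectory (k : nat -> R.-pker Om ~> S) :
  (forall t (w w' : Om), agree t w w' ->
    forall U, measurable U -> k t w U = k t w' U) ->
  forall w0 : Om, exists P : probability Om R,
  (forall f, (forall w, 0 <= f w) -> measurable_fun [set: Om] f -> dep 0 f ->
    \int[P]_w f w = f w0) /\
  (forall t f, (forall w, 0 <= f w) -> measurable_fun [set: Om] f ->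
    dep t.+1 f -> \int[P]_w f w = \int[P]_w \int[k t w]_s f (upd t w s)).
Proof. exact: (@ionescu_tulcea _ S R k). Qed.

Lemma measurable_steps t : measurable_fun [set: Om] (steps t : Om -> t.-tuple S).
Proof.
apply/measurable_fun_tnthP => i.
rewrite (_ : _ \o _ = fun w : Om => w i); first exact: measurable_trajectory_coordinate.
by apply/funext => w /=; rewrite tnth_mktuple.
Qed.

Lemma measurable_history_of t :
  measurable_fun [set: Om] (history_of t : Om -> history t).
Proof.
apply: measurable_fun_pair; first exact: measurable_steps.
exact: (measurableT_comp measurable_fst (measurable_trajectory_coordinate t)).
Qed.

Lemma steps_agree t (w w' : Om) : agree t w w' -> steps t w = steps t w'.
Proof. by move=> ww'; apply: eq_from_tnth => i; rewrite !tnth_mktuple ww'. Qed.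

Let state_kernel t : R.-pker Om ~> borel X :=
  if t is m.+1 then kprecomp q (measurable_trajectory_coordinate m)
  else kdirac (@measurable_cst _ _ Om (borel X) setT x).

Let mhist t : measurable_fun [set: Om * borel X]
  (fun wy : Om * borel X => (steps t wy.1, wy.2) : history t).
Proof.
apply: measurable_fun_pair => //.
by apply: measurableT_comp => //; exact: measurable_steps.
Qed.

Let mpair : measurable_fun [set: (Om * borel X) * borel A]
  (fun wya : (Om * borel X) * borel A => (wya.1.2, wya.2) : S).
Proof.
apply: measurable_fun_pair => //.
exact: (measurableT_comp measurable_snd measurable_fst).
Qed.

Let pair_kernel t : R.-pker Om ~> S :=
  pkcomp (state_kernel t) (pkcomp (kprecomp (pi t) (@mhist t)) (kdirac mpair)).

Let integral_pair_kernel t w (g : S -> \bar R) : (forall s, 0 <= g s) ->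
  measurable_fun [set: S] g ->
  \int[pair_kernel t w]_s g s =
  \int[state_kernel t w]_y \int[pi t (steps t w, y)]_a g (y, a).
Proof.
move=> g0 mg; rewrite integral_pkcomp//; apply: eq_integral => y _.
rewrite integral_pkcomp//; apply: eq_integral => a _.
by rewrite integral_dirac// diracT mul1e.
Qed.

Let pair_kernel_agree t (w w' : Om) : agree t w w' ->
  forall U, measurable U -> pair_kernel t w U = pair_kernel t w' U.
Proof.
move=> ww' U mU; rewrite -(setIT U) -!integral_indic//.
have mU1 : measurable_fun [set: S] (fun s => (\1_U s : R)%:E).
  exact/measurable_EFinP.
have sE : state_kernel t w = state_kernel t w'.
  by case: t ww' => //= t ww'; rewrite /kprecomp (ww' t).
rewrite !integral_pair_kernel//.
by rewrite sE (steps_agree ww').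
Qed.

Lemma strategic_measure_exists : exists P, is_strategic_measure q pi x P.
Proof.
have [P [P0 PS]] := ionescu_tulcea_trajectory pair_kernel_agree (point : Om).
have steps_upd t (w : Om) (s : S) : steps t (upd t w s : Om) = steps t w.
  by apply: steps_agree; apply: agree_sym; exact: agree_upd.
have PE (C : set Om) t : measurable C -> dep t.+1 C ->
    P C = \int[P]_w \int[state_kernel t w]_y \int[pi t (steps t w, y)]_a
      (\1_C (upd t w (y, a) : Om))%:E.
  move=> mC dC; have -> : P C = \int[P]_w (\1_C w)%:E by rewrite integral_indic// setIT.
  rewrite [LHS](PS t).
  - apply: eq_integral => w _; rewrite integral_pair_kernel//.
    apply/measurable_EFinP.
    apply: (@measurableT_comp _ _ _ _ _ _ (\1_C : Om -> R)); first exact: measurable_indic.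
    exact: (@measurable_upd_new _ S t w).
  - by move=> w; rewrite lee_fin.
  - exact/measurable_EFinP.
  - by move=> w w' ww'; rewrite (dep_indic R dC ww').
exists P; split.
- move=> B mB.
  have mC : measurable [set w : Om | B (w 0%N).1].
    rewrite -[X in measurable X]setTI.
    by apply: (measurableT_comp measurable_fst (measurable_trajectory_coordinate 0)).
  rewrite (PE _ 0%N)//; last first.
    by move=> w w' /(_ 0%N (ltn0Sn _)) ww'; rewrite /mkset ww'.
  rewrite (eq_integral (cst (\d_(x : borel X) B))).
    rewrite integral_cst// -[RHS]mule1; congr (_ * _); exact: probability_setT.
  move=> w _; rewrite (eq_integral (fun y => (\1_B y : R)%:E)).
    by rewrite integral_indic// setIT.
  move=> y _; rewrite (eq_integral (cst (\1_B y : R)%:E)).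
    by rewrite integral_cst// prob_kernel mule1.
  by move=> a _; rewrite !indicE.
- move=> t E D mE mD.
  have mEh : measurable [set w : Om | E (history_of t w)].
    by rewrite -[X in measurable X]setTI; apply: (@measurable_history_of t).
  have mDh : measurable [set w : Om | D (w t).2].
    rewrite -[X in measurable X]setTI.
    by apply: (measurableT_comp measurable_snd (measurable_trajectory_coordinate t)).
  rewrite (PE _ t); last 2 first.
  - exact: measurableI.
  - move=> w w' ww'; rewrite /mkset /history_of (ww' t)//.
    by rewrite (steps_agree (agreeW (leqnSn t) ww')).
  (* As a function of the history, the right-hand integrand does not involve the action at time t.
     The one-step identity then applies to both sides, and on the right the integral over that
     action is trivial. *)
  pose g (h : history t) : \bar R := pi t h D * (\1_E h)%:E.
  have g0 h : 0 <= g h by rewrite mule_ge0// lee_fin.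
  have mg : measurable_fun [set: history t] g.
    apply: emeasurable_funM; first exact: measurable_kernel.
    exact/measurable_EFinP.
  have histE w (s : S) : history_of t (upd t w s : Om) = (steps t w, s.1).
    by rewrite /history_of steps_upd updE.
  have gE (w : Om) : g (history_of t w) =
      ((fun w => pi t (history_of t w) D) \_ [set w | E (history_of t w)]) w.
    rewrite patchE /g indicE; case: ifPn => h.
      by rewrite mem_set ?mule1//; move: h; rewrite inE.
    by rewrite memNset ?mule0// => Ew; move: h; rewrite notin_setE; apply.
  transitivity (\int[P]_w g (history_of t w)); last first.
    by rewrite [RHS]integral_mkcond; apply: eq_integral => w _; exact: gE.
  rewrite [RHS](PS t (fun w => g (history_of t w)))//; last 2 first.
  - exact: (measurableT_comp mg (@measurable_history_of t)).
  - move=> w w' ww'; rewrite /history_of (ww' t)//.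
    by rewrite (steps_agree (agreeW (leqnSn t) ww')).
  apply: eq_integral => w _; rewrite integral_pair_kernel//; last first.
    have mh : measurable_fun [set: S] (fun s : S => history_of t (upd t w s : Om)).
      apply: (measurableT_comp (@measurable_history_of t)).
      exact: (@measurable_upd_new _ S t w).
    exact: (measurableT_comp mg mh).
  apply: eq_integral => y _; under [RHS]eq_integral do rewrite histE /=.
  rewrite integral_cst// prob_kernel mule1.
  rewrite (eq_integral (fun a => (\1_E (steps t w, y))%:E * (\1_D a : R)%:E)).
    rewrite ge0_integralZl//; last exact/measurable_EFinP.
    by rewrite integral_indic// setIT muleC.
  move=> a _; rewrite -EFinM !indicE -natrM mulnb; congr (nat_of_bool _)%:R%:E.
  apply/idP/andP; rewrite !inE /mkset histE updE //=.
- move=> t E B mE mB.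
  have mEs : measurable [set w : Om | E (steps t.+1 w)].
    by rewrite -[X in measurable X]setTI; apply: (@measurable_steps t.+1).
  have mBs : measurable [set w : Om | B (w t.+1).1].
    rewrite -[X in measurable X]setTI.
    by apply: (measurableT_comp measurable_fst (measurable_trajectory_coordinate t.+1)).
  rewrite (PE _ t.+1); last 2 first.
  - exact: measurableI.
  - move=> w w' ww'; rewrite /mkset (ww' t.+1)//.
    by rewrite (steps_agree (agreeW (leqnSn t.+1) ww')).
  rewrite [RHS]integral_mkcond; apply: eq_integral => w _.
  rewrite (eq_integral (fun y => (\1_E (steps t.+1 w))%:E * (\1_B y : R)%:E)); last first.
    move=> y _; rewrite (eq_integral (cst ((\1_E (steps t.+1 w))%:E * (\1_B y : R)%:E))).
      by rewrite integral_cst// prob_kernel mule1.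
    move=> a _; rewrite -EFinM !indicE -natrM mulnb; congr (nat_of_bool _)%:R%:E.
    by apply/idP/andP; rewrite !inE /mkset steps_upd updE.
  rewrite ge0_integralZl//; last exact/measurable_EFinP.
  rewrite integral_indic// setIT patchE indicE; case: ifPn => h.
    by rewrite mem_set ?mul1e//; move: h; rewrite inE.
  by rewrite memNset ?mul0e// => Ew; move: h; rewrite notin_setE; apply.
Qed.

End strategic_measure_existence.

(** * Minimization over actions and discounted costs *)

Section compact_levels.
Context {R : realType}.

Lemma compact_level_exists (T : ptopologicalType) (G : (T -> \bar R)^nat)
    (L : \bar R) : hausdorff_space T ->
  (forall n a, 0 <= G n a) ->
  (forall n l, compact [set a | G n a <= l%:E]) ->
  (forall a, nondecreasing_seq (G ^~ a)) ->
  (forall n, exists a, G n a <= L) -> exists a, forall n, G n a <= L.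
Proof.
move=> hT G0 cG ndG GL; case: L GL => [l| |] GL.
- have [||||a aP] := @compact_bigcap_nonempty T (fun n => [set a | G n a <= l%:E]).
  + exact: hT.
  + by move=> n; exact: cG.
  + exact: GL.
  + by move=> n a /=; apply: le_trans; exact: (ndG a n n.+1).
  by exists a => n; exact: (aP n I).
- by exists point => n; exact: leey.
- have [a] := GL 0%N; rewrite leeNy_eq => /eqP G0a.
  by have := G0 0%N a; rewrite G0a.
Qed.

Lemma compact_level_min (T : ptopologicalType) (G : T -> \bar R) :
  hausdorff_space T -> (forall a, 0 <= G a) ->
  (forall l, compact [set a | G a <= l%:E]) ->
  exists a, G a = ereal_inf (range G).
Proof.
move=> hT G0 cG; set m := ereal_inf _.
have Gm a : m <= G a by apply: ereal_inf_lbound; exists a.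
have m0 : 0 <= m by apply: le_ereal_inf_tmp => _ [a _ <-].
suff [a Ga] : exists a, G a <= m by exists a; apply/eqP; rewrite eq_le Ga Gm.
move mE : m m0 => m' m'0.
case: m' m'0 mE => [r r0 mr|_ mr|//]; last by exists point; exact: leey.
have [||||a aP] := @compact_bigcap_nonempty T
    (fun n => [set a | G a <= (r + n.+1%:R^-1)%:E]).
- exact: hT.
- by move=> n; exact: cG.
- move=> n; have : m < (r + n.+1%:R^-1)%:E by rewrite mr lte_fin ltrDl invr_gt0.
  by move=> /ereal_inf_lt[_ [a _ <-] /ltW]; exists a.
- move=> n a /=; move/le_trans; apply; rewrite lee_fin lerD2l lef_pV2 ?posrE//.
  by rewrite ler_nat.
exists a; apply/lee_addgt0Pr => e e0.
have [n _ /(_ n (leqnn n)) ne] := near_infty_natSinv_lt (PosNum e0).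
apply: le_trans (aP n I) _; rewrite -EFinD lee_fin lerD2l; exact: ltW ne.
Qed.

(** A sum is at most [l] iff, for every real [r], the first term is at most [r] or the second at
    most [l - r]: an intersection of unions of two closed sets. *)
Lemma closed_level_add (T : topologicalType) (g F : T -> \bar R) :
  (forall a, 0 <= g a) -> (forall a, 0 <= F a) ->
  (forall r, closed [set a | g a <= r%:E]) ->
  (forall r, closed [set a | F a <= r%:E]) ->
  forall l, closed [set a | g a + F a <= l%:E].
Proof.
move=> g0 F0 cg cF l.
rewrite (_ : [set a | _] = \bigcap_(r in [set: R])
  ([set a | g a <= r%:E] `|` [set a | F a <= (l - r)%:E])).
  by apply: closed_bigI => r _; apply: closedU.
apply/seteqP; split => a /=.
  move=> gF r _; have [gr|rg] := leP (g a) r%:E; [by left|right] => /=.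
  rewrite EFinB leeBrDl//; apply: le_trans gF; rewrite leeD2r//; exact: ltW.
move=> h; have Fg (r : R) : r%:E < g a -> F a <= (l - r)%:E.
  by move=> rg; have [/=|//] := h r I; rewrite leNgt rg.
case: (g a) (g0 a) Fg => [s s0 Fg|_ Fg|//].
  apply/lee_addgt0Pr => e e0; have := Fg (s - e)%R.
  rewrite lte_fin ltrBlDr ltrDl e0 => /(_ isT) FF.
  apply: le_trans (leeD2l _ FF) _; rewrite -!EFinD lee_fin; lra.
(* For infinite [g a], taking [r] = [l + 1] would force [F a] to be at most -1. *)
have := Fg (l + 1)%R (ltry _); rewrite opprD addNKr => /(le_trans (F0 a)).
by rewrite lee_fin oppr_ge0 ler10.
Qed.

End compact_levels.

(** Setwise continuity is stated along sequences; the metric of the ambient Polish space makes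
    sequences sufficient for closedness. *)
Lemma polish_seq_closed (R : realType) (T : topologicalType) (F : set T) :
  borel_subset_of_polish R T ->
  (forall (s : nat -> T) a, (forall n, F (s n)) -> s @ \oo --> a -> F a) ->
  closed F.
Proof.
move=> [P [i [_ _ inji emb _]]] seqF a Fa.
have ci : continuous i by apply/continuousP => V oV; apply/emb; exists V.
have /choice[s sP] n : exists x, F x /\ ball (i a) (n.+1%:R^-1 : R)%R (i x).
  have [x [Fx ax]] : F `&` (i @^-1` ball (i a) (n.+1%:R^-1 : R)%R) !=set0.
    by apply: Fa; apply: ci; apply: nbhsx_ballx; rewrite invr_gt0.
  by exists x.
apply: (seqF s) => [n|U]; first exact: (sP n).1.
rewrite nbhsE => -[V [oV Va] VU].
have /emb[W oW WV] := oV.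
have /nbhs_ballP[e /= e0 eW] : nbhs (i a) W.
  by apply: open_nbhs_nbhs; split => //; rewrite WV in Va.
have [N _ NP] := near_infty_natSinv_lt (PosNum e0).
exists N => // n Nn; apply: VU; rewrite WV; apply: eW.
by apply: le_ball (sP n).2; exact/ltW/NP.
Qed.

Section setwise_continuity.
Import HBNNSimple.
Context {R : realType} {X A : ptopologicalType}.
Hypothesis polishA : borel_subset_of_polish R A.
Variable q : R.-pker (borel X * borel A) ~> borel X.
Hypothesis q_setwise : forall (x : X) (s : nat -> A) (a : A), s @ \oo --> a ->
  forall B : set (borel X), measurable B ->
    q (x, s n) B @[n --> \oo] --> q (x, a) B.

(* Fatou's lemma for setwise convergence: the integral is a supremum of finite
   combinations of continuous functions of the action. *)
Lemma closed_level_integral (f : borel X -> \bar R) (x : X) (l : R) :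
  (forall y, 0 <= f y) -> measurable_fun [set: borel X] f ->
  closed [set a : A | \int[q (x, a)]_y f y <= l%:E].
Proof.
move=> f0 mf; apply: (polish_seq_closed polishA) => s a sl sa /=.
pose h := nnsfun_approx measurableT mf.
have hf n y : (h n y)%:E <= f y.
  have nd : nondecreasing_seq (fun k => (h k y)%:E).
    by move=> k m km; rewrite lee_fin; exact/lefP/nd_nnsfun_approx.
  have hy : (h k y)%:E @[k --> \oo] --> f y by exact: cvg_nnsfun_approx.
  rewrite (@cvg_unique _ (@ereal_hausdorff R) _ _ _ _ hy (ereal_nondecreasing_cvgn nd)).
  by apply: ereal_sup_ubound; exists n.
have -> : \int[q (x, a)]_y f y = limn (fun n => \int[q (x, a)]_y (h n y)%:E).
  rewrite -monotone_convergence//.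
  - by apply: eq_integral => y _; apply/esym/cvg_lim => //; exact: cvg_nnsfun_approx.
  - by move=> n; exact/measurable_EFinP.
  - by move=> n y _; rewrite lee_fin.
  - by move=> y _ m n mn; rewrite lee_fin; exact/lefP/nd_nnsfun_approx.
apply: lime_le.
  apply: ereal_nondecreasing_is_cvgn => m n mn; apply: ge0_le_integral => //.
  - by move=> y _; rewrite lee_fin.
  - exact/measurable_EFinP.
  - exact/measurable_EFinP.
  - by move=> y _; rewrite lee_fin; exact/lefP/nd_nnsfun_approx.
apply: nearW => n.
have cvh : \int[q (x, s k)]_y (h n y)%:E @[k --> \oo] --> \int[q (x, a)]_y (h n y)%:E.
  have intE (mu : {measure set (borel X) -> \bar R}) : \int[mu]_y (h n y)%:E =
      \sum_(r <- finmap.enum_fset (fset_set (range (h n))) |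
        r \in finmap.enum_fset (fset_set (range (h n))))
        r%:E * mu (h n @^-1` [set r]).
    by rewrite -big_seq integralT_nnsfun sintegralE fsbig_finite.
  rewrite intE; under eq_fun do rewrite intE.
  have inr r : r \in finmap.enum_fset (fset_set (range (h n))) -> (0 <= r)%R.
    move=> rin; have : r \in range (h n).
      by rewrite -(in_fset_set (fimfunP (h n))); exact: rin.
    by rewrite inE => -[y _ <-].
  apply: cvg_nnesum => r /inr r0.
    by apply: nearW => k; rewrite mule_ge0.
  by apply: cvgeZl => //; exact: q_setwise.
rewrite -(cvg_lim _ cvh)//; apply: lime_le; first by apply/cvg_ex; eexists; exact: cvh.
apply: nearW => k; apply: le_trans (sl k); apply: ge0_le_integral => //.
- by move=> y _; rewrite lee_fin.
- exact/measurable_EFinP.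
Qed.

End setwise_continuity.

Section minimization_over_actions.
Context {R : realType} {X A : ptopologicalType}.
Hypotheses (polishX : borel_subset_of_polish R X)
           (polishA : borel_subset_of_polish R A).

Definition action_inf (G : borel X * borel A -> \bar R) (x : borel X) : \bar R :=
  ereal_inf (range (fun a : A => G (x, a))).

Lemma action_inf_le G x a : action_inf G x <= G (x, a).
Proof. by apply: ereal_inf_lbound; exists a. Qed.

Lemma action_inf_ge0 G x : (forall z, 0 <= G z) -> 0 <= action_inf G x.
Proof. by move=> G0; apply: le_ereal_inf_tmp => _ [a _ <-]. Qed.

Section fixed_cost.
Variable G : borel X * borel A -> \bar R.
Hypotheses (G0 : forall z, 0 <= G z)
  (mG : measurable_fun [set: borel X * borel A] G)
  (cG : forall (x : X) l, compact [set a : A | G (x, a) <= l%:E]).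

Lemma action_inf_attained x : exists a, G (x, a) = action_inf G x.
Proof.
have [hA _ _] := polish_facts polishA.
exact: (@compact_level_min _ _ (fun a : A => G (x, a)) hA).
Qed.

(** Minima are attained, so the infimum is at most [r] exactly on the projection of a level set of
    [G], whose sections are compact. *)
Lemma measurable_action_inf : measurable_fun [set: borel X] (action_inf G).
Proof.
apply: (measurability _ (ErealGenOInfty.measurableE R)) => //.
move=> _ [_ [r ->] <-]; rewrite setTI.
have mK : measurable [set z | G z <= r%:E].
  by rewrite -[X in measurable X]setTI; exact: emeasurable_fun_infty_c.
have -> : action_inf G @^-1` `]r%:E, +oo[ = ~` (fst @` [set z | G z <= r%:E]).
  apply/seteqP; split => [x /=|x /= nx].
    rewrite in_itv /= andbT => rG [[x' a] /= Ga xE]; rewrite xE in Ga.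
    by move: rG; rewrite ltNge => /negP; apply; apply: le_trans Ga; exact: action_inf_le.
  rewrite in_itv /= andbT ltNge; apply/negP => Gr; apply: nx.
  by have [a Ga] := action_inf_attained x; exists (x, a) => //=; rewrite Ga.
apply: measurableC; apply: (measurable_projection polishX polishA mK) => x.
exact: cG.
Qed.

(** Finiteness of the infimum makes each set of minimizers a level set at a real level, hence
    compact; at level +oo it would be all of [A]. *)
Lemma measurable_minimizer : (forall x, action_inf G x < +oo) ->
  exists phi : borel X -> borel A,
    measurable_fun [set: borel X] phi /\ forall x, G (x, phi x) = action_inf G x.
Proof.
move=> Gfin.
have fin x : action_inf G x \is a fin_num by rewrite ge0_fin_numE// action_inf_ge0.
pose K := [set z | G z <= action_inf G z.1].
have mK : measurable K.
  rewrite /K -[X in measurable X]setTI; apply: emeasurable_fun_le => //.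
  exact: (measurableT_comp measurable_action_inf measurable_fst).
have [||phi [mphi Kphi]] := measurable_uniformization polishX polishA mK.
- move=> x; have -> : [set a : A | K (x, a)] =
      [set a : A | G (x, a) <= (fine (action_inf G x))%:E].
    by apply/seteqP; split => a; rewrite /K /= fineK.
  exact: cG.
- by move=> x; have [a Ga] := action_inf_attained x; exists a; rewrite /K /= Ga.
exists phi; split => // x; apply/eqP; rewrite eq_le Kphi.
exact: action_inf_le.
Qed.

End fixed_cost.

Variable q : R.-pker (borel X * borel A) ~> borel X.
Hypothesis q_setwise : forall (x : X) (s : nat -> A) (a : A), s @ \oo --> a ->
  forall B : set (borel X), measurable B ->
    q (x, s n) B @[n --> \oo] --> q (x, a) B.
Variable g : borel X * borel A -> \bar R.
Hypotheses (g0 : forall z, 0 <= g z)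
  (mg : measurable_fun [set: borel X * borel A] g)
  (cg : forall (x : X) l, compact [set a : A | g (x, a) <= l%:E]).

Definition bellman (f : borel X -> \bar R) (z : borel X * borel A) : \bar R :=
  g z + \int[q z]_y f y.

Lemma bellman_ge0 f z : (forall y, 0 <= f y) -> 0 <= bellman f z.
Proof. by move=> f0; rewrite adde_ge0// integral_ge0. Qed.

Lemma measurable_bellman f : (forall y, 0 <= f y) ->
  measurable_fun [set: borel X] f ->
  measurable_fun [set: borel X * borel A] (bellman f).
Proof.
move=> f0 mf; apply: emeasurable_funD => //.
apply: measurable_fun_integral_kernel => // U mU.
exact: measurable_kernel.
Qed.

(** Lower semicontinuity of both terms makes the level set closed, and nonnegativity of the integral
    places it inside a compact level set of [g]. *)
Lemma compact_level_bellman f (x : X) l : (forall y, 0 <= f y) ->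
  measurable_fun [set: borel X] f ->
  compact [set a : A | bellman f (x, a) <= l%:E].
Proof.
move=> f0 mf; have [hA _ _] := polish_facts polishA.
apply: (@subclosed_compact _ _ [set a : A | g (x, a) <= l%:E]) => //.
  apply: (@closed_level_add _ _ (fun a : A => g (x, a))
    (fun a : A => \int[q (x, a)]_y f y)) => // [a|r|r].
  - exact: integral_ge0.
  - by apply: compact_closed => //; exact: cg.
  - exact: (closed_level_integral polishA q_setwise).
by move=> a; apply: le_trans; rewrite leeDl// integral_ge0.
Qed.

Lemma bellman_mono f f' z : (forall y, 0 <= f y) ->
  measurable_fun [set: borel X] f -> measurable_fun [set: borel X] f' ->
  (forall y, f y <= f' y) -> bellman f z <= bellman f' z.
Proof.
by move=> f0 mf mf' ff'; rewrite leeD2l// ge0_le_integral// => y _; exact: (le_trans (f0 y)).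
Qed.

(* The exchange of the limit with the minimum over actions, from compactness. *)
Lemma bellman_sup_le (f : (borel X -> \bar R)^nat) (x : X) (L : \bar R) :
  (forall n y, 0 <= f n y) -> (forall n, measurable_fun [set: borel X] (f n)) ->
  (forall y, nondecreasing_seq (f ^~ y)) ->
  (forall n, action_inf (bellman (f n)) x <= L) ->
  exists a, bellman (fun y => ereal_sup (range (f ^~ y))) (x, a) <= L.
Proof.
move=> f0 mf ndf fL; have [hA _ _] := polish_facts polishA.
have [||||a aP] := @compact_level_exists _ A (fun n a => bellman (f n) (x, a)) L hA.
- by move=> n a; exact: bellman_ge0.
- by move=> n l; exact: compact_level_bellman.
- by move=> a m n mn; apply: bellman_mono => // y; exact: ndf.
- move=> n; have [||a aE] := @action_inf_attained (bellman (f n)) _ _ x.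
  + by move=> z; exact: bellman_ge0.
  + by move=> y l; exact: compact_level_bellman.
  by exists a; rewrite aE.
exists a.
have cvf : \int[q (x, a)]_y f n y @[n --> \oo] -->
    \int[q (x, a)]_y ereal_sup (range (f ^~ y)).
  rewrite (eq_integral (fun y => limn (f ^~ y))); last first.
    move=> y _; apply/esym/cvg_lim => //.
    exact: ereal_nondecreasing_cvgn (ndf y).
  by apply: cvg_monotone_convergence => // y _; exact: ndf.
rewrite /bellman; have cvb : bellman (f n) (x, a) @[n --> \oo] -->
    g (x, a) + \int[q (x, a)]_y ereal_sup (range (f ^~ y)).
  apply: cvgeD => //; last exact: cvg_cst.
  rewrite ge0_adde_def// inE ?g0// integral_ge0// => y _.
  by apply: le_trans (f0 0%N y) _; apply: ereal_sup_ubound; exists 0%N.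
rewrite -(cvg_lim _ cvb)//; apply: lime_le; first by apply/cvg_ex; eexists; exact: cvb.
by apply: nearW => n; exact: aP.
Qed.

End minimization_over_actions.

(** * Expectations under a strategic measure *)

Section strategic_expectations.
Context {R : realType} {X A : ptopologicalType}.
Variables (q : R.-pker (borel X * borel A) ~> borel X)
  (pi : policy (R := R) (X := X) (A := A)) (x : X)
  (P : probability (@trajectory X A) R).
Hypothesis sP : is_strategic_measure q pi x P.

Local Notation S := (borel X * borel A)%type.
Local Notation Om := (@trajectory X A).

Lemma measurable_state t : measurable_fun [set: Om] (fun w : Om => (w t).1).
Proof. exact: (measurableT_comp measurable_fst (measurable_trajectory_coordinate t)). Qed.

Lemma expectation_initial_state (f : borel X -> \bar R) : (forall y, 0 <= f y) ->
  measurable_fun [set: borel X] f -> \int[P]_w f (w 0%N).1 = f x.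
Proof.
move=> f0 mf; rewrite -[LHS](@ge0_integral_pushforward _ _ _ _ _ _ (measurable_state 0) _ setT)//.
transitivity (\int[\d_(x : borel X)]_y f y); last first.
  by rewrite integral_dirac// diracT mul1e.
apply: eq_measure_integral => [|? B mB _]; first exact: measurable_state.
by have [/(_ B mB)] := sP.
Qed.

Lemma expectation_next_state t (f : borel X -> \bar R) : (forall y, 0 <= f y) ->
  measurable_fun [set: borel X] f ->
  \int[P]_w f (w t.+1).1 = \int[P]_w \int[q (w t)]_y f y.
Proof.
move=> f0 mf.
(* Seen as a constant kernel from [unit], [P] can be composed with [q], and the rule for integrals
   against composite kernels applies. *)
pose l : R.-pker unit ~> Om := kprobability (@measurable_cst _ _ unit _ setT (P : pprobability Om R)).
pose k : R.-pker (unit * Om) ~> borel X :=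
  kprecomp q (measurableT_comp (measurable_trajectory_coordinate t) (@measurable_snd _ _ unit Om)).
transitivity (\int[pkcomp l k tt]_y f y); last by rewrite integral_pkcomp.
rewrite -[LHS](@ge0_integral_pushforward _ _ _ _ _ _ (measurable_state t.+1) _ setT)//.
apply: eq_measure_integral => [|? B mB _]; first exact: measurable_state.
have [_ _ /(_ t setT B measurableT mB)] := sP.
rewrite [X in P X](_ : _ = (fun w : Om => (w t.+1).1) @^-1` B); last first.
  by apply/seteqP; split => [w []//|w ?]; split.
by rewrite [X in \int[P]_(w in X) _](_ : _ = setT).
Qed.

(** The laws of the two pairs agree on rectangles, a generating class stable under intersection,
    hence everywhere. *)
Lemma expectation_stationary (phi : borel X -> borel A) t (f : S -> \bar R) :
  measurable_fun [set: borel X] phi ->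
  (forall h (D : set (borel A)), measurable D -> pi t h D = \d_(phi h.2) D) ->
  (forall z, 0 <= f z) -> measurable_fun [set: S] f ->
  \int[P]_w f (w t) = \int[P]_w f ((w t).1, phi (w t).1).
Proof.
move=> mphi piE f0 mf.
have m1 := measurable_trajectory_coordinate (X := X) (A := A) t.
have m2 : measurable_fun [set: Om] (fun w : Om => ((w t).1, phi (w t).1) : S).
  apply: measurable_fun_pair; first exact: measurable_state.
  exact: (measurableT_comp mphi (measurable_state t)).
rewrite -[LHS](@ge0_integral_pushforward _ _ _ _ _ _ m1 _ setT)//.
rewrite -[RHS](@ge0_integral_pushforward _ _ _ _ _ _ m2 _ setT)//.
apply: eq_measure_integral => C mC _.
apply: (@measure_unique _ _ _ [set B `*` D | B in measurable & D in measurable]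
  (fun=> setT)) => //.
- by rewrite measurable_prod_measurableType.
- move=> _ _ [B1 mB1 [D1 mD1 <-]] [B2 mB2 [D2 mD2 <-]].
  exists (B1 `&` B2); first exact: measurableI.
  by exists (D1 `&` D2); [exact: measurableI|rewrite setXI].
- by move=> _; exists setT => //; exists setT => //; rewrite setXTT.
- by rewrite bigcup_const.
- move=> _ [B mB [D mD <-]].
  have [_ /(_ t [set h : @history X A t | B h.2] D) + _] := sP.
  have mB2 : measurable [set h : @history X A t | B h.2].
    by rewrite -[X in measurable X]setTI; exact: measurable_snd.
  move=> /(_ mB2 mD).
  rewrite [X in P X = _](_ : _ = (fun w : Om => w t : S) @^-1` (B `*` D)); last first.
    by apply/seteqP; split => w.
  rewrite /= /pushforward => ->.
  rewrite (eq_integral (fun w : Om => (\1_D (phi (w t).1))%:E)); last first.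
    by move=> w _; rewrite piE// diracE indicE.
  have mD2 : measurable ((fun w : Om => phi (w t).1) @^-1` D).
    rewrite -[X in measurable X]setTI.
    exact: (measurableT_comp mphi (measurable_state t)).
  have -> : (fun w : Om => (\1_D (phi (w t).1) : R)%:E) =
      (fun w => (\1_((fun w : Om => phi (w t).1) @^-1` D) w)%:E) by [].
  rewrite integral_indic//; last first.
    by rewrite -[X in measurable X]setTI; apply: measurable_state.
  by congr (P _); apply/seteqP; split => w [].
- move=> _; have : P setT < +oo by rewrite probability_setT ltry.
  exact.
Qed.

Definition stage_cost (g : S -> \bar R) t : \bar R := \int[P]_w g (w t).

(* Only the marginal recursion of the strategic measure is used: the law of
   x_{t+1} is obtained from that of (x_t, a_t) by the kernel [q]. *)
Lemma discounted_lower_bound (g : S -> \bar R) (alpha : R) (V : (borel X -> \bar R)^nat) n t :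
  (0 <= alpha)%R -> (forall z, 0 <= g z) -> measurable_fun [set: S] g ->
  (forall n y, 0 <= V n y) -> (forall n, measurable_fun [set: borel X] (V n)) ->
  V 0%N = cst 0 ->
  (forall n z, V n.+1 z.1 <= bellman q g (fun y => alpha%:E * V n y) z) ->
  \int[P]_w V n (w t).1 <= \sum_(0 <= i < n) (alpha ^+ i)%:E * stage_cost g (t + i).
Proof.
move=> a0 g0 mg V0 mV V00 VS; elim: n t => [|n ih] t.
  by rewrite big_nil V00 integral0.
have mgt : measurable_fun [set: Om] (fun w : Om => g (w t)).
  exact: (measurableT_comp mg (measurable_trajectory_coordinate t)).
have mVS : measurable_fun [set: Om] (fun w : Om => \int[q (w t)]_y V n y).
  have mq : measurable_fun [set: S] (fun z => \int[q z]_y V n y).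
    by apply: measurable_fun_integral_kernel => // U mU; exact: measurable_kernel.
  exact: (measurableT_comp mq (measurable_trajectory_coordinate t)).
apply: (@le_trans _ _ (\int[P]_w (g (w t) + alpha%:E * \int[q (w t)]_y V n y))).
  apply: ge0_le_integral => //.
  - exact: (measurableT_comp (mV n.+1) (measurable_state t)).
  - by apply: emeasurable_funD => //; exact: measurable_funeM.
  - by move=> w _; apply: le_trans (VS n (w t)) _; rewrite /bellman ge0_integralZl.
rewrite ge0_integralD//; last 2 first.
- by move=> w _; rewrite mule_ge0// integral_ge0.
- exact: measurable_funeM.
rewrite ge0_integralZl//; last by move=> w _; exact: integral_ge0.
rewrite -expectation_next_state// big_nat_recl// expr0 mul1e addn0 leeD2l//.
apply: (@le_trans _ _ (alpha%:E * \sum_(0 <= i < n) (alpha ^+ i)%:E * stage_cost g (t.+1 + i))).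
  by rewrite lee_wpmul2l.
rewrite ge0_sume_distrr; last first.
  by move=> i _; rewrite mule_ge0// ?lee_fin ?exprn_ge0// integral_ge0.
by apply: lee_sum => i _; rewrite muleA -EFinM -exprS addSnnS.
Qed.

(** It serves twice: with [W] = 0 and a discount below 1 it shows that the minimizing policy attains
    the optimal value; with [alpha] = 1 it bounds an average cost. *)
Lemma stationary_upper_bound (g : S -> \bar R) (alpha W : R) (V : borel X -> \bar R)
    (phi : borel X -> borel A) N :
  (0 <= alpha)%R -> (0 <= W)%R -> (forall z, 0 <= g z) -> measurable_fun [set: S] g ->
  (forall y, 0 <= V y) -> measurable_fun [set: borel X] V ->
  measurable_fun [set: borel X] phi ->
  (forall t h (D : set (borel A)), measurable D -> pi t h D = \d_(phi h.2) D) ->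
  (forall y, bellman q g (fun y => alpha%:E * V y) (y, phi y) <= W%:E + V y) ->
  \sum_(0 <= t < N) (alpha ^+ t)%:E * stage_cost g t <=
    V x + (\sum_(0 <= t < N) alpha ^+ t * W)%R%:E.
Proof.
move=> a0 W0 g0 mg V0 mV mphi piE gV.
(* The induction needs the discounted expectation of the terminal [V], which is dropped afterwards
   as a nonnegative term. *)
suff : \sum_(0 <= t < N) (alpha ^+ t)%:E * stage_cost g t +
    (alpha ^+ N)%:E * \int[P]_w V (w N).1 <=
    V x + (\sum_(0 <= t < N) alpha ^+ t * W)%R%:E.
  apply: le_trans; rewrite leeDl// mule_ge0// ?lee_fin ?exprn_ge0//.
  exact: integral_ge0.
elim: N => [|N ih].
  by rewrite !big_nil add0e adde0 expr0 mul1e expectation_initial_state.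
rewrite !big_nat_recr//= EFinD [leRHS]addeA.
apply: le_trans (leeD2r (alpha ^+ N * W)%:E ih).
rewrite -!addeA leeD2l// exprSr EFinM -muleA.
rewrite -ge0_muleDr; last 2 first.
- exact: integral_ge0.
- by rewrite mule_ge0// integral_ge0.
rewrite EFinM -ge0_muleDr//; last exact: integral_ge0.
rewrite lee_wpmul2l// ?lee_fin ?exprn_ge0//.
have mgN : measurable_fun [set: Om] (fun w : Om => g (w N)).
  exact: (measurableT_comp mg (measurable_trajectory_coordinate N)).
have mVN : measurable_fun [set: Om] (fun w : Om => V (w N).1).
  exact: (measurableT_comp mV (measurable_state N)).
have mq : measurable_fun [set: S] (fun z => \int[q z]_y V y).
  by apply: measurable_fun_integral_kernel => // U mU; exact: measurable_kernel.
have mB : measurable_fun [set: S] (bellman q g (fun y => alpha%:E * V y)).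
  apply: measurable_bellman => // [y|]; first by rewrite mule_ge0.
  exact: measurable_funeM.
have bE (z : S) : bellman q g (fun y => alpha%:E * V y) z = g z + alpha%:E * \int[q z]_y V y.
  by rewrite /bellman ge0_integralZl.
have B0 z : 0 <= bellman q g (fun y => alpha%:E * V y) z.
  by apply: bellman_ge0 => // y; rewrite mule_ge0.
have -> : stage_cost g N + alpha%:E * \int[P]_w V (w N.+1).1 =
    \int[P]_w bellman q g (fun y => alpha%:E * V y) (w N).
  under [RHS]eq_integral do rewrite bE.
  rewrite [RHS]ge0_integralD//; last 2 first.
  - by move=> w _; rewrite mule_ge0// integral_ge0.
  - apply: measurable_funeM.
    exact: (measurableT_comp mq (measurable_trajectory_coordinate N)).
  rewrite [in RHS]ge0_integralZl//; last 2 first.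
  - exact: (measurableT_comp mq (measurable_trajectory_coordinate N)).
  - by move=> w _; exact: integral_ge0.
  by rewrite expectation_next_state.
rewrite (expectation_stationary mphi (piE N))//.
apply: (@le_trans _ _ (\int[P]_w (V (w N).1 + W%:E))).
  apply: ge0_le_integral => //.
  - have m2 : measurable_fun [set: Om] (fun w : Om => ((w N).1, phi (w N).1) : S).
      apply: measurable_fun_pair; first exact: measurable_state.
      exact: (measurableT_comp mphi (measurable_state N)).
    exact: (measurableT_comp mB m2).
  - exact: emeasurable_funD.
  - by move=> w _; rewrite addeC.
rewrite ge0_integralD// integral_cst// leeD2l//.
by rewrite [X in _ * X](_ : _ = 1) ?mule1//; exact: probability_setT.
Qed.

End strategic_expectations.

(** For negative [k] and an infinite integral of [f], the sum may be neither nonnegative nor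
    integrable. Its negative part is bounded, hence of finite integral under mass 1, and moving it
    to the other side leaves only nonnegative summands. *)
Lemma integralD_cst (d : measure_display) (T : measurableType d) (R : realType)
    (P : {measure set T -> \bar R}) (f : T -> \bar R) (k : R) :
  P setT = 1 -> (forall x, 0 <= f x) ->
  measurable_fun [set: T] f -> \int[P]_x (f x + k%:E) = \int[P]_x f x + k%:E.
Proof.
move=> P1 f0 mf.
have cstE (r : R) : \int[P]_x r%:E = r%:E.
  by rewrite (integral_cst P measurableT r%:E) P1 mule1.
have pos (r : R) (h : T -> \bar R) : (0 <= r)%R -> (forall x, 0 <= h x) ->
    measurable_fun [set: T] h -> \int[P]_x (h x + r%:E) = \int[P]_x h x + r%:E.
  by move=> r0 h0 mh; rewrite ge0_integralD// cstE.
have [k0|/ltW k0] := leP 0%R k; first exact: pos.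
pose r := (- k)%R; have r0 : (0 <= r)%R by rewrite oppr_ge0.
have -> : k = (- r)%R by rewrite opprK.
pose h x := f x + (- r)%:E.
have mh : measurable_fun [set: T] h by exact: emeasurable_funD.
have hneg x : h^\- x <= r%:E.
  rewrite funenegE ge_max lee_fin r0 andbT /h.
  case: (f x) (f0 x) => [s s0|_|//]; last by rewrite addye// leNye.
  by move: s0; rewrite -EFinD -EFinN !lee_fin; lra.
have hE x : h^\+ x + r%:E = f x + h^\- x.
  rewrite funeposE funenegE /h; case: (f x) (f0 x) => [s| _|//]; last first.
    by rewrite [+oo + (- r)%:E]addye// max_l ?leey// max_r ?leNye// !addye.
  rewrite lee_fin => s0; rewrite -!EFinD -EFinN -!EFin_max -!EFinD; congr EFin.
  have [h1|h1] := leP 0%R (s - r)%R.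
    by rewrite max_r; lra.
  by rewrite max_l; lra.
have mhp : measurable_fun [set: T] h^\+ by exact: measurable_funepos.
have mhn : measurable_fun [set: T] h^\- by exact: measurable_funeneg.
have intn : \int[P]_x h^\- x \is a fin_num.
  rewrite ge0_fin_numE ?integral_ge0//; apply: (@le_lt_trans _ _ r%:E); last exact: ltry.
  by rewrite -[leRHS]cstE; apply: ge0_le_integral.
have : \int[P]_x (h^\+ x + r%:E) = \int[P]_x (f x + h^\- x).
  by apply: eq_integral => x _; exact: hE.
have -> : \int[P]_x (h^\+ x + r%:E) = \int[P]_x h^\+ x + r%:E by exact: pos.
have -> : \int[P]_x (f x + h^\- x) = \int[P]_x f x + \int[P]_x h^\- x.
  exact: ge0_integralD.
have -> : \int[P]_x (f x + (- r)%:E) = \int[P]_x h^\+ x - \int[P]_x h^\- x.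
  exact: (integralE P setT h).
move: (\int[P]_x h^\- x) intn (\int[P]_x h^\+ x) (\int[P]_x f x) => [i| |]// _.
move=> [p| |] [s| |]//= [e]; congr EFin; lra.
Qed.

(** * Costs shifted by a constant *)

Section shifted_costs.
Context {R : realType} {X A : ptopologicalType}.
Local Notation S := (borel X * borel A)%type.
Local Notation Om := (@trajectory X A).

Lemma strategic_measureP (q : R.-pker S ~> borel X) (pi : policy (R := R)) (x : X) :
  is_strategic_measure q pi x (strategic_measure q pi x).
Proof.
have [P sP] := strategic_measure_exists q pi x.
by apply: (@xgetPex _ _ [set P | is_strategic_measure q pi x P]); exists P.
Qed.

Variables (g : S -> \bar R) (M : R).
Hypotheses (g0 : forall z, 0 <= g z) (mg : measurable_fun [set: S] g).
Let c z := g z + M%:E.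
Variable q : R.-pker S ~> borel X.

Let mgt t : measurable_fun [set: Om] (fun w : Om => g (w t)).
Proof. exact: (measurableT_comp mg (measurable_trajectory_coordinate t)). Qed.

Let c_scale (r : R) z : (0 <= r)%R -> r%:E * c z = r%:E * g z + (r * M)%:E.
Proof. by move=> r0; rewrite muleDr// ?fin_num_adde_defl// EFinM. Qed.

Lemma finite_horizon_cost_shift N pi (x : X) :
  finite_horizon_cost c q N 1 pi x =
  \sum_(0 <= t < N) stage_cost (strategic_measure q pi x) g t + (N%:R * M)%:E.
Proof.
rewrite /finite_horizon_cost.
rewrite (eq_integral (fun w : Om => \sum_(0 <= t < N) g (w t) + (N%:R * M)%:E)).
  rewrite integralD_cst ?ge0_integral_sum//.
  - exact: probability_setT.
  - by move=> w; exact: sume_ge0.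
  - exact: emeasurable_sum.
move=> w _; under eq_bigr do rewrite c_scale ?exprn_ge0// !expr1n mul1e mul1r.
by rewrite big_split/= sumEFin big_const_nat subn0 iter_addr_0 mulr_natl.
Qed.

Lemma discounted_cost_shift (alpha : R) pi (x : X) : (0 <= alpha < 1)%R ->
  discounted_cost c q alpha pi x =
  \sum_(0 <= t <oo) (alpha ^+ t)%:E * stage_cost (strategic_measure q pi x) g t +
  (M / (1 - alpha))%:E.
Proof.
move=> /andP[a0 a1]; rewrite /discounted_cost.
have ag0 t (w : Om) : 0 <= (alpha ^+ t)%:E * g (w t) by rewrite mule_ge0// lee_fin exprn_ge0.
have magt t : measurable_fun [set: Om] (fun w : Om => (alpha ^+ t)%:E * g (w t)).
  exact: measurable_funeM.
rewrite (eq_integral (fun w : Om => \sum_(0 <= t <oo) (alpha ^+ t)%:E * g (w t) +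
    (M / (1 - alpha))%:E)).
  rewrite integralD_cst.
  - congr (_ + _); rewrite integral_nneseries//; apply: eq_eseriesr => t _.
    by rewrite ge0_integralZl// lee_fin exprn_ge0.
  - exact: probability_setT.
  - by move=> w; exact: nneseries_ge0.
  - exact: ge0_emeasurable_sum.
move=> w _; apply/cvg_lim => //.
have -> : (fun n => \sum_(0 <= t < n) (alpha ^+ t)%:E * c (w t)) =
    (fun n => \sum_(0 <= t < n) (alpha ^+ t)%:E * g (w t) +
      (series (geometric M alpha) n)%:E).
  apply/funext => n; under eq_bigr do rewrite c_scale ?exprn_ge0//.
  rewrite big_split/= sumEFin; congr (_ + _%:E); apply: eq_bigr => t _.
  by rewrite mulrC.
apply: cvgeD.
- by rewrite fin_num_adde_defl.
- exact: is_cvg_nneseries.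
- apply: cvg_EFin; first exact: nearW.
  by apply: cvg_geometric_series; rewrite ger0_norm.
Qed.

End shifted_costs.

Lemma ereal_infD_cst (R : realType) (I : Type) (D : set I) (f : I -> \bar R) (k : R) :
  ereal_inf [set f i + k%:E | i in D] = ereal_inf [set f i | i in D] + k%:E.
Proof.
apply/eqP; rewrite eq_le; apply/andP; split.
  rewrite -leeBlDr//; apply: le_ereal_inf_tmp => _ [i Di <-].
  by rewrite leeBlDr//; apply: ereal_inf_lbound; exists i.
apply: le_ereal_inf_tmp => _ [i Di <-]; rewrite leeD2r//.
by apply: ereal_inf_lbound; exists i.
Qed.

(** * Value iteration and discounted optimality *)

Section dynamic_programming.
Context {R : realType} {X A : ptopologicalType}.
Hypotheses (polishX : borel_subset_of_polish R X)
           (polishA : borel_subset_of_polish R A).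
Local Notation S := (borel X * borel A)%type.
Variable q : R.-pker S ~> borel X.
Hypothesis q_setwise : forall (x : X) (s : nat -> A) (a : A), s @ \oo --> a ->
  forall B : set (borel X), measurable B ->
    q (x, s n) B @[n --> \oo] --> q (x, a) B.
Variable g : S -> \bar R.
Hypotheses (g0 : forall z, 0 <= g z) (mg : measurable_fun [set: S] g)
  (cg : forall (x : X) l, compact [set a : A | g (x, a) <= l%:E]).

Definition stationary_policy (phi : borel X -> borel A)
    (mphi : measurable_fun [set: borel X] phi) : policy (R := R) (X := X) (A := A) :=
  fun t => kdirac (measurableT_comp mphi (@measurable_snd _ _ (t.-tuple S) (borel X))).

Fixpoint value_iteration (alpha : R) n : borel X -> \bar R :=
  if n is m.+1 then action_inf (bellman q g (fun y => alpha%:E * value_iteration alpha m y))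
  else cst 0.

(** The limit of value iteration. Its equality with the infimum over policies is shown later, once
    values are known to be finite. *)
Definition optimal_value (alpha : R) (y : borel X) : \bar R :=
  ereal_sup (range (fun n => value_iteration alpha n y)).

Definition discounted_sum (alpha : R) (pi : policy (R := R) (X := X) (A := A)) (x : X) : \bar R :=
  \sum_(0 <= t <oo) (alpha ^+ t)%:E * stage_cost (strategic_measure q pi x) g t.

Section fixed_discount.
Variable alpha : R.
Hypothesis a01 : (0 <= alpha < 1)%R.
Let a0 : (0 <= alpha)%R. Proof. by case/andP: a01. Qed.

Let V n := value_iteration alpha n.

Lemma value_iteration_ge0_measurable n :
  (forall y, 0 <= V n y) /\ measurable_fun [set: borel X] (V n).
Proof.
elim: n => [|n [V0 mV]]; first by split => //; exact: measurable_cst.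
have aV0 y : 0 <= alpha%:E * V n y by rewrite mule_ge0.
have maV : measurable_fun [set: borel X] (fun y => alpha%:E * V n y).
  exact: measurable_funeM.
split=> [y|]; first by apply: action_inf_ge0 => z; exact: bellman_ge0.
apply: measurable_action_inf => //.
- by move=> z; exact: bellman_ge0.
- exact: measurable_bellman.
- by move=> x l; exact: compact_level_bellman.
Qed.

Let V0 n y : 0 <= V n y. Proof. exact: (value_iteration_ge0_measurable n).1. Qed.
Let mV n : measurable_fun [set: borel X] (V n).
Proof. exact: (value_iteration_ge0_measurable n).2. Qed.
Let aV0 n y : 0 <= alpha%:E * V n y. Proof. by rewrite mule_ge0. Qed.
Let maV n : measurable_fun [set: borel X] (fun y => alpha%:E * V n y).
Proof. exact: measurable_funeM. Qed.

Lemma value_iteration_nondecreasing y : nondecreasing_seq (fun n => V n y).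
Proof.
apply/nondecreasing_seqP => n; elim: n y => [|n ih] y; first exact: V0.
apply: le_ereal_inf_tmp => _ [a _ <-].
apply: le_trans (action_inf_le _ y a) _.
apply: bellman_mono; [exact: (aV0 n)|exact: (maV n)|exact: (maV n.+1)|move=> z].
by rewrite lee_wpmul2l// ih.
Qed.

Lemma cvg_value_iteration y : V n y @[n --> \oo] --> optimal_value alpha y.
Proof. exact: ereal_nondecreasing_cvgn (value_iteration_nondecreasing y). Qed.

Lemma optimal_value_ge n y : V n y <= optimal_value alpha y.
Proof. by apply: ereal_sup_ubound; exists n. Qed.

Lemma optimal_value_ge0 y : 0 <= optimal_value alpha y.
Proof. exact: le_trans (V0 0 y) (optimal_value_ge 0 y). Qed.

Lemma measurable_optimal_value : measurable_fun [set: borel X] (optimal_value alpha).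
Proof.
apply: (@emeasurable_fun_cvg _ _ _ _ V) => //.
by move=> y _; exact: cvg_value_iteration.
Qed.

(** One inequality is monotonicity; the other exchanges the supremum over stages with the minimum
    over actions, through [bellman_sup_le]. *)
Lemma optimality_equation y : optimal_value alpha y =
  action_inf (bellman q g (fun y => alpha%:E * optimal_value alpha y)) y.
Proof.
apply/eqP; rewrite eq_le; apply/andP; split.
  apply: ge_ereal_sup => _ [[|n] _ <-].
    apply: action_inf_ge0 => z; apply: bellman_ge0 => // y'.
    by rewrite mule_ge0// optimal_value_ge0.
  apply: le_ereal_inf_tmp => _ [a _ <-].
  apply: le_trans (action_inf_le _ y a) _; apply: bellman_mono => //.
    by apply: measurable_funeM; exact: measurable_optimal_value.
  by move=> z; rewrite lee_wpmul2l// optimal_value_ge.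
have [||||a] := @bellman_sup_le _ _ _ polishA q q_setwise g g0 cg
  (fun n y => alpha%:E * V n y) y (optimal_value alpha y).
- exact: aV0.
- exact: maV.
- by move=> z n m nm; rewrite lee_wpmul2l// value_iteration_nondecreasing.
- by move=> n; exact: (optimal_value_ge n.+1).
apply: le_trans; apply: le_trans (action_inf_le _ y a) _.
rewrite le_eqVlt; apply/orP; left; apply/eqP; congr (_ + _).
apply: eq_integral => z _.
have cv1 : alpha%:E * V n z @[n --> \oo] --> alpha%:E * optimal_value alpha z.
  by apply: cvgeZl => //; exact: cvg_value_iteration.
apply: (@cvg_unique _ (@ereal_hausdorff R) _ _ _ _ cv1).
apply: ereal_nondecreasing_cvgn => n m nm.
by rewrite lee_wpmul2l// value_iteration_nondecreasing.
Qed.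

Lemma optimal_value_le_discounted_sum pi x : optimal_value alpha x <= discounted_sum alpha pi x.
Proof.
apply: ge_ereal_sup => _ [n _ <-].
have sP := strategic_measureP q pi x.
rewrite -[leLHS]/(V n x) -(expectation_initial_state sP (V0 n) (mV n)).
apply: le_trans (@discounted_lower_bound _ _ _ _ _ _ _ sP g alpha V n 0 _ _ _ _ _ _ _) _ => //.
  by move=> m [y a]; exact: action_inf_le.
under eq_bigr do rewrite add0n.
apply: nneseries_lim_ge => t _ _.
by rewrite mule_ge0// ?lee_fin ?exprn_ge0//; apply: integral_ge0.
Qed.

Lemma optimal_value_attained : (forall y, optimal_value alpha y < +oo) ->
  exists pi, forall x, discounted_sum alpha pi x <= optimal_value alpha x.
Proof.
move=> vfin.
have ov0 y : 0 <= alpha%:E * optimal_value alpha y.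
  by rewrite mule_ge0// optimal_value_ge0.
have mov : measurable_fun [set: borel X] (fun y => alpha%:E * optimal_value alpha y).
  by apply: measurable_funeM; exact: measurable_optimal_value.
have [||||phi [mphi phiE]] := @measurable_minimizer _ _ _ polishX polishA
  (bellman q g (fun y => alpha%:E * optimal_value alpha y)).
- by move=> z; exact: bellman_ge0.
- exact: measurable_bellman.
- by move=> x l; exact: compact_level_bellman.
- by move=> x; rewrite -optimality_equation.
exists (stationary_policy mphi) => x.
have sP := strategic_measureP q (stationary_policy mphi) x.
apply: lime_le.
  apply: is_cvg_nneseries => t _ _.
  by rewrite mule_ge0// ?lee_fin ?exprn_ge0//; apply: integral_ge0.
apply: nearW => n.
have := @stationary_upper_bound _ _ _ q _ x _ sP g alpha 0
  (optimal_value alpha) phi n a0 (lexx _) g0 mg optimal_value_ge0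
  measurable_optimal_value mphi (fun t h D mD => erefl).
have -> : (\sum_(0 <= t < n) alpha ^+ t * 0)%R = 0%R :> R.
  by rewrite big1// => t _; rewrite mulr0.
rewrite adde0.
by apply => y; rewrite add0e phiE -optimality_equation.
Qed.

End fixed_discount.
End dynamic_programming.

(** * Vanishing discount *)

Section limits.
Context {R : realType}.

Lemma limn_esup_le_near (v : (\bar R)^nat) l :
  (\forall n \near \oo, v n <= l) -> limn_esup v <= l.
Proof.
move=> [N _ hN]; rewrite limn_esup_lim.
rewrite (cvg_lim _ (@cvg_esups_inf R v))//.
apply: (@le_trans _ _ (esups v N)); first by apply: ereal_inf_lbound; exists N.
by apply: ge_ereal_sup => _ [n /= Nn <-]; exact: hN.
Qed.

Lemma limn_esup_lt_near (v : (\bar R)^nat) l :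
  limn_esup v < l -> \forall n \near \oo, v n <= l.
Proof.
rewrite limn_esup_lim (cvg_lim _ (@cvg_esups_inf R v))//.
move=> /ereal_inf_lt[_ [N _ <-] Nl]; exists N => // n /= Nn.
by apply: le_trans (ltW Nl); apply: ereal_sup_ubound; exists n.
Qed.

(** The induction carries the bound [alpha ^+ n] times the partial sum plus [1 - alpha ^+ n] times
    [C]; each step gains [alpha ^+ n] times [1 - alpha] times the gap between [C] and the next
    partial sum. *)
Lemma abel_sum_le (alpha C : R) (d : R^nat) n : (0 <= alpha <= 1)%R ->
  (forall N, \sum_(0 <= t < N) d t <= C)%R -> (0 <= C)%R ->
  (\sum_(0 <= t < n) alpha ^+ t * d t <= C)%R.
Proof.
move=> /andP[a0 a1] dC C0.
have an0 k : (0 <= alpha ^+ k)%R by rewrite exprn_ge0.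
have : (\sum_(0 <= t < n) alpha ^+ t * d t <=
    alpha ^+ n * (\sum_(0 <= t < n) d t) + (1 - alpha ^+ n) * C)%R.
  elim: n => [|n ih]; first by rewrite !big_nil expr0 subrr mul0r mulr0 addr0.
  rewrite !big_nat_recr//= exprS.
  have := dC n.+1; rewrite big_nat_recr//=.
  set D := (\sum_(0 <= t < n) d t)%R in ih *; move=> DC.
  have := ler_wpM2l (an0 n) DC.
  have : (0 <= alpha ^+ n * (1 - alpha) * (C - (D + d n)))%R.
    by rewrite !mulr_ge0// subr_ge0.
  move: ih; set S := (\sum_(0 <= t < n) _)%R; set b := (alpha ^+ n)%R; nra.
move=> /le_trans; apply.
have := ler_wpM2l (an0 n) (dC n); lra.
Qed.

(* Summation by parts, through [abel_sum_le]. *)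
Lemma abelian_bound (a : (\bar R)^nat) (L : R) : (forall t, 0 <= a t) ->
  (\forall N \near \oo, \sum_(0 <= t < N) a t <= (N%:R * L)%:E) ->
  exists2 C : R, (0 <= C)%R & forall alpha, (0 <= alpha < 1)%R ->
    \sum_(0 <= t <oo) (alpha ^+ t)%:E * a t <= (L / (1 - alpha) + C)%:E.
Proof.
move=> a0 [N0 _ hN0].
have Smono n m : (n <= m)%N -> \sum_(0 <= t < n) a t <= \sum_(0 <= t < m) a t.
  by move=> nm; apply: lee_sum_nneg_natr.
have afin t : a t \is a fin_num.
  rewrite ge0_fin_numE//; apply: (@le_lt_trans _ _ (\sum_(0 <= t < maxn t.+1 N0) a t)).
    apply: (@le_trans _ _ (\sum_(0 <= t < t.+1) a t)); last by apply: Smono; exact: leq_maxl.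
    by rewrite big_nat_recr//= leeDr// sume_ge0.
  by apply: le_lt_trans (hN0 _ (leq_maxr _ _)) _; exact: ltry.
pose b t := fine (a t).
have aE t : a t = (b t)%:E by rewrite fineK.
have b0 t : (0 <= b t)%R by rewrite fine_ge0.
have SE n : \sum_(0 <= t < n) a t = (\sum_(0 <= t < n) b t)%:E.
  by rewrite -sumEFin; apply: eq_bigr => t _; exact: aE.
have hb N : (N0 <= N)%N -> (\sum_(0 <= t < N) b t <= N%:R * L)%R.
  by move=> NN; rewrite -lee_fin -SE; exact: hN0.
have L0 : (0 <= L)%R.
  have := hb N0.+1 (leqnSn _); have : (0 <= \sum_(0 <= t < N0.+1) b t)%R.
    exact: sumr_ge0.
  move=> /le_trans /[apply]; rewrite pmulr_rge0//.
(* This constant bounds the partial sums of [b t - L]: from [N0] on they are nonpositive, and before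
   it they do not exceed the sum of [b] up to [N0]. *)
exists (N0%:R * L)%R => [|alpha /andP[al0 al1]]; first by rewrite mulr_ge0.
have al01 : (0 <= alpha <= 1)%R by rewrite al0 ltW.
have dC N : (\sum_(0 <= t < N) (b t - L) <= N0%:R * L)%R.
  rewrite sumrB big_const_nat subn0 iter_addr_0 -[(L *+ N)%R]mulr_natl lerBlDr.
  have [NN|/ltnW NN] := leqP N0 N.
    by apply: le_trans (hb N NN) _; rewrite lerDr mulr_ge0.
  rewrite -lee_fin -SE; apply: le_trans (Smono _ _ NN) _; rewrite SE lee_fin.
  by apply: le_trans (hb N0 (leqnn _)) _; rewrite lerDl mulr_ge0.
apply: lime_le.
  by apply: is_cvg_nneseries => t _ _; rewrite mule_ge0// lee_fin exprn_ge0.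
apply: nearW => n.
have -> : \sum_(0 <= t < n) (alpha ^+ t)%:E * a t = (\sum_(0 <= t < n) alpha ^+ t * b t)%:E.
  by rewrite -sumEFin; apply: eq_bigr => t _; rewrite aE.
rewrite lee_fin.
have := abel_sum_le n al01 dC (mulr_ge0 (ler0n _ _) L0).
under eq_bigr do rewrite mulrBr; rewrite sumrB lerBlDr => /le_trans; apply.
rewrite addrC lerD2r -mulr_suml mulrC ler_wpM2l//.
have al1' : (0 < 1 - alpha)%R by rewrite subr_gt0.
have -> : (\sum_(0 <= t < n) alpha ^+ t = series (geometric 1 alpha) n)%R.
  by apply: eq_bigr => t _; rewrite /= mul1r.
rewrite geometric_seriesE ?lt_eqF//= mul1r ler_pdivrMr// mulVf ?gt_eqF//.
by rewrite gerBl exprn_ge0.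
Qed.

(** The bound opposite to Fatou's. Truncated at height [K], the functions are dominated by a
    constant, integrable under mass 1; asymptotic uniform integrability makes the part above [K]
    small. Each receives half of [e]. *)
Lemma aui_limn_esup_le (d : measure_display) (T : measurableType d)
    (P : {measure set T -> \bar R}) (f : (T -> \bar R)^nat) (u : T -> \bar R) :
  P setT = 1 ->
  (forall n y, 0 <= f n y) -> (forall n, measurable_fun [set: T] (f n)) ->
  measurable_fun [set: T] u -> (forall y, f n y @[n --> \oo] --> u y) ->
  asymptotically_uniformly_integrable P f ->
  forall e : R, (0 < e)%R ->
    \forall n \near \oo, \int[P]_y f n y <= \int[P]_y u y + e%:E.
Proof.
move=> P1 f0 mf mu fu aui e e0.
have u0 y : 0 <= u y.
  by rewrite -(cvg_lim _ (fu y))//; apply: lime_ge; [apply/cvg_ex; eexists; exact: fu|exact: nearW].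
have [uoo|ufin] := eqVneq (\int[P]_y u y) +oo.
  by apply: nearW => n; rewrite uoo addye// leey.
have {}ufin : \int[P]_y u y \is a fin_num by rewrite ge0_fin_numE ?ltey ?integral_ge0.
have e2 : (0 < e / 2)%R by rewrite divr_gt0.
have [K [K0 AK]] : exists K : R, (0 <= K)%R /\ limn_esup (fun n =>
    \int[P]_y (`|f n y| * (\1_[set z | (K%:E <= `|f n z|)%E] y)%:E)) < (e / 2)%:E.
  have lte2 : nbhs (0 : \bar R) [set z | z < (e / 2)%:E].
    by apply: open_nbhs_nbhs; split; [exact: open_ereal_lt_ereal|rewrite /= lte_fin].
  have [K0 [_ hK]] := aui _ lte2.
  (* The limit at infinity speaks of heights strictly above [K0], hence the + 1; the maximum with 0
     keeps truncations nonnegative. *)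
  exists (Num.max (K0 + 1) 0)%R; split; first by rewrite le_max lexx orbT.
  by apply: hK; rewrite lt_max ltrDl ltr01.
have hA := limn_esup_lt_near AK.
pose h n y := mine (f n y) K%:E.
have mh n : measurable_fun [set: T] (h n) by apply: measurable_mine.
have h0 n y : 0 <= h n y by rewrite le_min f0 lee_fin.
have hu y : h n y @[n --> \oo] --> mine (u y) K%:E.
  have cK : (fun=> K%:E) @ \oo --> K%:E by exact: cvg_cst.
  exact: cvg_comp (cvg_pair (fu y) cK) (@min_continuous _ (\bar R) (u y, K%:E)).
have [||||_ _ cv] := @dominated_convergence _ _ _ P setT measurableT h
  (fun y => mine (u y) K%:E) (cst K%:E) mh.
- exact: measurable_mine.
- by apply/aeW => y _; exact: hu.
- apply/integrableP; split => //; rewrite (eq_integral (cst K%:E)).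
    by rewrite integral_cst// P1 mule1 ltry.
  by move=> y _; rewrite /= ger0_norm.
- by apply/aeW => y n _ /=; rewrite gee0_abs// ge_min lexx orbT.
have hh : \forall n \near \oo, \int[P]_y h n y <= \int[P]_y u y + (e / 2)%:E.
  have : \int[P]_y mine (u y) K%:E < \int[P]_y u y + (e / 2)%:E.
    apply: (@le_lt_trans _ _ (\int[P]_y u y)).
      apply: ge0_le_integral => //.
      - by move=> y _; rewrite le_min u0 lee_fin.
      - exact: measurable_mine.
      - by move=> y _; rewrite ge_min lexx.
    by rewrite lteDl// lte_fin.
  move=> lt; have : \forall n \near \oo, \int[P]_y h n y < \int[P]_y u y + (e / 2)%:E.
    apply: (cv [set z | z < \int[P]_y u y + (e / 2)%:E]).
    by apply: open_nbhs_nbhs; split; [exact: open_ereal_lt_ereal|exact: lt].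
  by apply: filterS => n /ltW.
pose tail n y := `|f n y| * (\1_[set z | (K%:E <= `|f n z|)%E] y)%:E.
have tail0 n y : 0 <= tail n y by rewrite mule_ge0// lee_fin.
have mtail n : measurable_fun [set: T] (tail n).
  apply: emeasurable_funM; first exact: measurableT_comp.
  apply/measurable_EFinP; apply: measurable_indic.
  rewrite -[X in measurable X]setTI; apply: emeasurable_fun_c_infty => //.
  exact: measurableT_comp.
have le_tail n y : f n y <= h n y + tail n y.
  rewrite /h; have [fK|Kf] := leP (f n y) K%:E; first by rewrite leeDl.
  rewrite /tail indicE mem_set ?mule1/=; last by rewrite gee0_abs// ltW.
  by rewrite gee0_abs// leeDr// lee_fin.
have int_le n : \int[P]_y f n y <= \int[P]_y h n y + \int[P]_y tail n y.
  rewrite -ge0_integralD//; apply: ge0_le_integral => //.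
  exact: emeasurable_funD.
near=> n; apply: le_trans (int_le n) _.
have -> : \int[P]_y u y + e%:E = \int[P]_y u y + (e / 2)%:E + (e / 2)%:E.
  by rewrite -addeA -EFinD; congr (_ + _%:E); lra.
by apply: leeD; near: n.
Unshelve. all: by end_near.
Qed.

End limits.

Section vanishing_discount.
Context {R : realType} {X A : ptopologicalType}.
Hypotheses (polishX : borel_subset_of_polish R X)
           (polishA : borel_subset_of_polish R A).
Local Notation S := (borel X * borel A)%type.
Variable q : R.-pker S ~> borel X.
Hypothesis q_setwise : forall (x : X) (s : nat -> A) (a : A), s @ \oo --> a ->
  forall B : set (borel X), measurable B ->
    q (x, s n) B @[n --> \oo] --> q (x, a) B.
Variables (g : S -> \bar R) (M : R).
Hypotheses (g0 : forall z, 0 <= g z) (mg : measurable_fun [set: S] g)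
  (cg : forall (x : X) l, compact [set a : A | g (x, a) <= l%:E]).
Local Notation c := (fun z => g z + M%:E).
Hypothesis B : assumption_B c q.

Lemma average_cost_discounted_sum (pi : policy (R := R) (X := X) (A := A)) (x : X) (l : R) :
  average_cost c q pi x < l%:E -> exists2 C : R, (0 <= C)%R & forall alpha,
    (0 <= alpha < 1)%R ->
    discounted_sum q g alpha pi x <= ((l - M) / (1 - alpha) + C)%:E.
Proof.
move=> /limn_esup_lt_near [N0 _ hN]; apply: abelian_bound.
  by move=> t; apply: integral_ge0.
(* The successor keeps [N] positive, so that the average can be multiplied by [N]. *)
exists N0.+1 => // N /= NN.
have N0' : (0 < N%:R :> R)%R by rewrite ltr0n (leq_ltn_trans _ NN).
have := hN N (ltnW NN).
rewrite /= finite_horizon_cost_shift//.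
move=> /(lee_wpmul2l (_ : 0 <= N%:R%:E)) -/(_ (ltW N0')).
rewrite muleA -EFinM mulfV ?gt_eqF// mul1e -leeBrDr// -EFinM -EFinB.
by rewrite mulrBr.
Qed.

Lemma discounted_value_shift alpha (x : X) : (0 <= alpha < 1)%R ->
  discounted_value c q alpha x =
  ereal_inf (range (fun pi => discounted_sum q g alpha pi x)) + (M / (1 - alpha))%:E.
Proof.
move=> a01; rewrite -ereal_infD_cst; congr ereal_inf; apply: eq_imagel => pi _.
exact: discounted_cost_shift.
Qed.

Definition min_optimal_value alpha : \bar R := ereal_inf (range (optimal_value q g alpha)).

Lemma min_optimal_value_ge0 alpha : (0 <= alpha < 1)%R -> 0 <= min_optimal_value alpha.
Proof.
move=> a01; apply: le_ereal_inf_tmp => _ [x _ <-].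
exact: (optimal_value_ge0 polishX polishA).
Qed.

Lemma wstar_discounted_sum (l : R) : wstar c q < l%:E -> exists2 C : R, (0 <= C)%R &
  forall alpha, (0 <= alpha < 1)%R -> exists x pi,
    discounted_sum q g alpha pi x <= ((l - M) / (1 - alpha) + C)%:E.
Proof.
move=> /ereal_inf_lt[_ [x _ <-]] /ereal_inf_lt[_ [pi _ <-]].
move=> /average_cost_discounted_sum[C C0 hC]; exists C => // alpha a01.
by exists x, pi; exact: hC.
Qed.

Lemma min_optimal_value_le (l : R) : wstar c q < l%:E -> exists2 C : R, (0 <= C)%R &
  forall alpha, (0 <= alpha < 1)%R ->
    min_optimal_value alpha <= ((l - M) / (1 - alpha) + C)%:E.
Proof.
move=> /wstar_discounted_sum[C C0 hC]; exists C => // alpha a01.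
have [x [pi]] := hC _ a01; apply: le_trans.
apply: (@le_trans _ _ (optimal_value q g alpha x)).
  by apply: ereal_inf_lbound; exists x.
exact: (optimal_value_le_discounted_sum polishX polishA).
Qed.

Lemma wstar_lt : exists l : R, wstar c q < l%:E.
Proof.
have [/ereal_inf_lt[_ [x _ <-]] wx _] := B.
(* If the value is -oo, [fine] returns 0 and any real bound works. *)
exists (fine (average_value c q x) + 1)%R.
apply: (@le_lt_trans _ _ (average_value c q x)).
  by apply: ereal_inf_lbound; exists x.
case: (average_value c q x) wx => //= [r _|_]; last exact: ltNyr.
by rewrite lte_fin ltrDl.
Qed.

(** * Relative values at one discount factor *)

Section fixed_discount.
Variable alpha : R.
Hypothesis a01 : (0 <= alpha < 1)%R.
Let a0 : (0 <= alpha)%R. Proof. by case/andP: a01. Qed.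
Let v := optimal_value q g alpha.
Let v0 y : 0 <= v y. Proof. exact: (optimal_value_ge0 polishX polishA). Qed.
Let mv : measurable_fun [set: borel X] v.
Proof. exact: (measurable_optimal_value polishX polishA). Qed.

Lemma min_optimal_value_fin : min_optimal_value alpha \is a fin_num.
Proof.
rewrite ge0_fin_numE ?min_optimal_value_ge0//.
have [l /min_optimal_value_le[C _ hC]] := wstar_lt.
by apply: le_lt_trans (hC _ a01) _; exact: ltry.
Qed.

Lemma relative_value_lt_pinfty (x : X) : relative_value c q alpha x < +oo.
Proof.
have [_ /(_ x)] := B; apply: le_lt_trans; apply: ereal_sup_ubound.
by exists alpha => //=; rewrite in_itv.
Qed.

Lemma min_discounted_value_lt_pinfty : min_discounted_value c q alpha < +oo.
Proof.
have [l /wstar_discounted_sum[C _ /(_ _ a01)[x [pi hx]]]] := wstar_lt.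
apply: (@le_lt_trans _ _ (discounted_value c q alpha x)).
  by apply: ereal_inf_lbound; exists x.
rewrite discounted_value_shift// lte_add_pinfty ?ltry//.
apply: (@le_lt_trans _ _ (discounted_sum q g alpha pi x)).
  by apply: ereal_inf_lbound; exists pi.
by apply: le_lt_trans hx _; exact: ltry.
Qed.

(** The minimum m_alpha is below +oo, so an infinite discounted value would make the relative value
    infinite, against Assumption B. *)
Lemma discounted_value_lt_pinfty (x : X) : discounted_value c q alpha x < +oo.
Proof.
have := relative_value_lt_pinfty x; rewrite /relative_value.
have := min_discounted_value_lt_pinfty.
case: (discounted_value _ _ _ _) => [r| |] //; first by rewrite ltry.
by case: (min_discounted_value _ _ _).
Qed.

(** Value iteration stays below every policy, so its limit is finite; finiteness permits the
    selection of a minimizer, whose stationary policy attains the bound. *)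
Lemma discounted_valueE (x : X) :
  discounted_value c q alpha x = v x + (M / (1 - alpha))%:E.
Proof.
have vle y : v y <= ereal_inf (range (fun pi => discounted_sum q g alpha pi y)).
  apply: le_ereal_inf_tmp => _ [pi _ <-].
  exact: (optimal_value_le_discounted_sum polishX polishA).
have vfin y : v y < +oo.
  apply: le_lt_trans (vle y) _; have := discounted_value_lt_pinfty y.
  by rewrite discounted_value_shift//; case: ereal_inf => [r _|//|_]; rewrite ?ltry ?ltNyr.
rewrite discounted_value_shift//; congr (_ + _); apply/eqP; rewrite eq_le vle andbT.
have [pi hpi] := optimal_value_attained polishX polishA q_setwise g0 mg cg a01 vfin.
by apply: le_trans (hpi x); apply: ereal_inf_lbound; exists pi.
Qed.

Lemma relative_valueE (x : X) :
  relative_value c q alpha x = v x - min_optimal_value alpha.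
Proof.
rewrite /relative_value /min_discounted_value.
have -> : [set discounted_value c q alpha y | y in [set: X]] =
    [set v y + (M / (1 - alpha))%:E | y in [set: X]].
  by apply: eq_imagel => y _; exact: discounted_valueE.
rewrite ereal_infD_cst discounted_valueE -/(min_optimal_value alpha).
rewrite -(fineK min_optimal_value_fin) -EFinD.
case: (v x) (v0 x) => [r _| _|]//; congr EFin; ring.
Qed.

Lemma relative_value_ge0 (x : X) : 0 <= relative_value c q alpha x.
Proof.
rewrite relative_valueE sube_ge0 ?min_optimal_value_fin//.
by apply: ereal_inf_lbound; exists x.
Qed.

Lemma measurable_relative_value :
  measurable_fun [set: borel X] (relative_value c q alpha : borel X -> \bar R).
Proof.
have -> : relative_value c q alpha = fun x => v x - min_optimal_value alpha.
  by apply/funext => x; exact: relative_valueE.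
exact: emeasurable_funB.
Qed.

(** With v = u + m and kernels of mass 1, the constant alpha m leaves the integral; subtracted from
    m, it yields (1 - alpha) m. *)
Lemma relative_optimality_equation (x : borel X) :
  (1 - alpha)%:E * min_optimal_value alpha + relative_value c q alpha x =
  action_inf (bellman q g (fun y => alpha%:E * relative_value c q alpha y)) x.
Proof.
have r0 := relative_value_ge0; have mr := measurable_relative_value.
rewrite relative_valueE.
rewrite /v (optimality_equation polishX polishA)//.
have m_fin := min_optimal_value_fin; set m := fine (min_optimal_value alpha).
have mE : min_optimal_value alpha = m%:E by rewrite fineK.
have -> : action_inf (bellman q g (fun y => alpha%:E * optimal_value q g alpha y)) x =
    action_inf (bellman q g (fun y => alpha%:E * relative_value c q alpha y)) x + (alpha * m)%:E.
  rewrite -ereal_infD_cst; congr ereal_inf; apply: eq_imagel => a _.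
  rewrite /bellman -addeA; congr (_ + _); rewrite -integralD_cst.
  - apply: eq_integral => y _; rewrite relative_valueE mE EFinM -muleDr//.
      by rewrite subeK.
    by rewrite fin_num_adde_defl.
  - exact: prob_kernel.
  - by move=> y; rewrite mule_ge0.
  - exact: measurable_funeM.
rewrite mE -EFinM; have : 0 <= action_inf (bellman q g
    (fun y => alpha%:E * relative_value c q alpha y)) x.
  by apply: action_inf_ge0 => z; apply: bellman_ge0 => // y; rewrite mule_ge0.
by case: action_inf => [s _|_|]//; congr EFin; ring.
Qed.

End fixed_discount.

(** * Limit along the sequence of discount factors *)

Section discount_sequence.
Variable alpha : R^nat.
Hypotheses (alpha_range : forall n, (0 <= alpha n < 1)%R)
  (alpha_cvg : alpha @ \oo --> (1%R : R))
  (u_cvg : forall x : X, cvgn (fun n => relative_value c q (alpha n) x))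
  (u_aui : forall (x : X) (a : A), asymptotically_uniformly_integrable (q (x, a))
     (fun n => relative_value c q (alpha n))).
Local Notation rel n := (relative_value c q (alpha n)).
Let u (x : X) : \bar R := limn_einf (fun n => rel n x).
Let r n : R := ((1 - alpha n) * fine (min_optimal_value (alpha n)))%R.
Let W : \bar R := limn_esup (fun n => (r n)%:E).

Let a0 n : (0 <= alpha n)%R. Proof. by case/andP: (alpha_range n). Qed.
Let a1 n : (alpha n <= 1)%R. Proof. by case/andP: (alpha_range n) => _ /ltW. Qed.
Let rel0 n x : 0 <= rel n x. Proof. exact: relative_value_ge0. Qed.
Let mrel n : measurable_fun [set: borel X] (rel n : borel X -> \bar R).
Proof. exact: measurable_relative_value. Qed.

Let arel0 n x : 0 <= (alpha n)%:E * rel n x.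
Proof.
by apply: mule_ge0; [rewrite lee_fin a0|exact: rel0].
Qed.
Let marel n : measurable_fun [set: borel X]
  ((fun x => (alpha n)%:E * rel n x) : borel X -> \bar R).
Proof. exact: measurable_funeM. Qed.

Let equation n (x : borel X) : (r n)%:E + rel n x =
  action_inf (bellman q g (fun y => (alpha n)%:E * rel n y)) x.
Proof.
by rewrite -relative_optimality_equation// EFinM fineK// min_optimal_value_fin.
Qed.

Lemma relative_value_cvg x : rel n x @[n --> \oo] --> u x.
Proof. by rewrite /u is_cvg_limn_einfE//; exact: u_cvg. Qed.

Lemma relative_limit_ge0 x : 0 <= u x.
Proof.
rewrite -(cvg_lim _ (@relative_value_cvg x))//.
by apply: lime_ge; [exact: u_cvg|exact: nearW].
Qed.

Lemma relative_limit_fin x : u x \is a fin_num.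
Proof.
rewrite ge0_fin_numE ?relative_limit_ge0//; have [_ /(_ x)] := B; apply: le_lt_trans.
rewrite -(cvg_lim _ (@relative_value_cvg x))//.
apply: lime_le; first exact: u_cvg.
apply: nearW => n; apply: ereal_sup_ubound; exists (alpha n) => //=.
by rewrite in_itv alpha_range.
Qed.

Lemma measurable_relative_limit : measurable_fun [set: borel X] (u : borel X -> \bar R).
Proof.
apply: (@emeasurable_fun_cvg _ _ _ _ (fun n => rel n : borel X -> \bar R)) => //.
by move=> x _; exact: relative_value_cvg.
Qed.

Let r0 n : (0 <= r n)%R.
Proof.
by rewrite mulr_ge0 ?subr_ge0// fine_ge0// min_optimal_value_ge0.
Qed.

Lemma vanishing_discount_ge0 : 0 <= W.
Proof.
rewrite /W limn_esup_lim (cvg_lim _ (@cvg_esups_inf R _))//.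
apply: le_ereal_inf_tmp => _ [n _ <-]; apply: (@le_trans _ _ (r n)%:E).
  by rewrite lee_fin.
by apply: ereal_sup_ubound; exists n => /=.
Qed.

(** Multiplied by [1 - alpha n], the constant [C] of the Abelian bound vanishes in the limit. With
    [l] close to [wstar] this gives [W + M] as a lower bound for [wstar]. *)
Lemma vanishing_discount_le (l : R) : wstar c q < l%:E -> W <= (l - M)%:E.
Proof.
move=> /min_optimal_value_le[C C0 hC]; apply/lee_addgt0Pr => e e0.
apply: limn_esup_le_near.
have : \forall n \near \oo, ((1 - alpha n) * C < e)%R.
  have cv : ((1 - alpha n) * C)%R @[n --> \oo] --> ((1 - 1) * C)%R.
    by apply: cvgMl; apply: cvgB => //; exact: cvg_cst.
  rewrite subrr mul0r in cv; apply: (cv [set z | z < e]%R).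
  exact: lt_nbhsl.
apply: filterS => n /ltW ne; rewrite -EFinD lee_fin.
have n1 : (0 < 1 - alpha n)%R by rewrite subr_gt0; case/andP: (alpha_range n).
have := hC _ (alpha_range n).
rewrite -(fineK (min_optimal_value_fin (alpha_range n))) lee_fin.
move=> /(ler_wpM2l (ltW n1)); rewrite -/(r n) => /le_trans; apply.
by rewrite mulrDr mulrCA mulfV ?gt_eqF// mulr1 lerD2l.
Qed.

Let W_fin : W \is a fin_num.
Proof.
rewrite ge0_fin_numE ?vanishing_discount_ge0//.
by have [l /vanishing_discount_le] := wstar_lt; move=> /le_lt_trans; apply; exact: ltry.
Qed.

(** At stage n, action [a] bounds the minimum and 1 bounds [alpha n]. Convergence handles the
    relative value at [x], [aui_limn_esup_le] the integral, and the resulting eventual bound on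
    [r n] passes to [W]. *)
Lemma optimality_inequality_le x (a : A) : W + u x <= bellman q g u (x, a).
Proof.
have : 0 <= bellman q g u (x, a) by apply: bellman_ge0 => // y; exact: relative_limit_ge0.
case bE : (bellman q g u (x, a)) => [L| |]// _; last by rewrite leey.
rewrite -leeBrDr ?relative_limit_fin//; apply/lee_addgt0Pr => e e0.
have e2 : (0 < e / 2)%R by rewrite divr_gt0.
apply: limn_esup_le_near.
have bound : \forall n \near \oo, \int[q (x, a)]_y rel n y <=
    \int[q (x, a)]_y u y + (e / 2)%:E.
  apply: aui_limn_esup_le => //; first exact: prob_kernel.
    exact: measurable_relative_limit.
  exact: relative_value_cvg.
have near_u : \forall n \near \oo, (fine (u x) - e / 2)%:E < rel n x.
  apply: (@relative_value_cvg x [set z | (fine (u x) - e / 2)%:E < z]).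
  apply: open_nbhs_nbhs; split; first exact: open_ereal_gt_ereal.
  by rewrite /= -[ltRHS](fineK (relative_limit_fin x)) lte_fin gtrDl oppr_lt0.
near=> n.
have hu : (fine (u x) - e / 2)%:E < rel n x by near: n.
have le_bellman : (r n)%:E + rel n x <= L%:E + (e / 2)%:E.
  rewrite equation; apply: le_trans (action_inf_le _ x a) _.
  apply: (@le_trans _ _ (bellman q g (rel n) (x, a))).
    apply: bellman_mono; [exact: arel0|exact: marel|exact: mrel|move=> y].
    by rewrite -[leRHS]mul1e; apply: lee_wpmul2r; [exact: rel0|rewrite lee_fin a1].
  by rewrite -bE -addeA leeD2l//; near: n.
have relfin : rel n x \is a fin_num by rewrite ge0_fin_numE// relative_value_lt_pinfty.
move: hu le_bellman; rewrite -(fineK relfin) -(fineK (relative_limit_fin x)).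
by rewrite -!EFinD !lee_fin lte_fin /=; lra.
Unshelve. all: by end_near.
Qed.

(** Exchanging limit and minimum requires monotone integrands, which the discounted relative values
    need not be; the lower envelopes [f k] are monotone and increase to [u]. *)
Lemma optimality_inequality_ge (x : borel X) : exists a : A, bellman q g u (x, a) <= W + u x.
Proof.
pose f k (y : borel X) := einfs (fun n => (alpha n)%:E * rel n y) k.
have f0 k y : 0 <= f k y by apply: le_ereal_inf_tmp => _ [n _ <-].
have mf k : measurable_fun [set: borel X] (f k).
  exact: (@measurable_fun_einfs _ _ _ _
    (fun n => (fun y => (alpha n)%:E * rel n y) : borel X -> \bar R)).
have ndf y : nondecreasing_seq (f ^~ y) by exact: nondecreasing_einfs.
have uE (y : borel X) : u y = ereal_sup (range (f ^~ y)).
  have cv : (alpha n)%:E * rel n y @[n --> \oo] --> 1%:E * u y.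
    apply: cvgeM; [by rewrite mule_def_fin// relative_limit_fin| |exact: relative_value_cvg].
    by apply: cvg_EFin; [exact: nearW|exact: alpha_cvg].
  rewrite mul1e in cv.
  rewrite -[LHS](cvg_lim _ (cvg_einfs cv))//.
  exact: cvg_lim (@cvg_einfs_sup R (fun n => (alpha n)%:E * rel n y)).
suff fL k : action_inf (bellman q g (f k)) x <= W + u x.
  have [a ha] := bellman_sup_le polishA q_setwise g0 cg f0 mf ndf fL.
  exists a; apply: le_trans ha; rewrite le_eqVlt; apply/orP; left; apply/eqP.
  by congr (_ + _); apply: eq_integral => y _; exact: uE.
apply/lee_addgt0Pr => e e0.
have Wlt : W < (fine W + e / 2)%:E.
  by rewrite -[ltLHS]fineK// lte_fin ltrDl divr_gt0.
have [N _ hN] := limn_esup_lt_near Wlt.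
have [N' _ hN'] : \forall n \near \oo, rel n x < (fine (u x) + e / 2)%:E.
  apply: (@relative_value_cvg x [set z | z < (fine (u x) + e / 2)%:E]).
  apply: open_nbhs_nbhs; split; first exact: open_ereal_lt_ereal.
  by rewrite /= -[ltLHS](fineK (relative_limit_fin x)) lte_fin ltrDl divr_gt0.
(* One index beyond all three suffices: [f k] lies below the integrand at n, and both estimates hold
   there. *)
pose n := (k + N + N')%N.
have -> : W + u x + e%:E = (fine W + e / 2)%:E + (fine (u x) + e / 2)%:E.
  rewrite -[in LHS](fineK W_fin) -[in LHS](fineK (relative_limit_fin x)) -!EFinD.
  by congr _%:E; lra.
apply: (@le_trans _ _ ((r n)%:E + rel n x)); last first.
  apply: leeD; [apply: hN|apply/ltW; apply: hN'] => /=; rewrite /n; lia.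
rewrite equation; apply: le_ereal_inf_tmp => _ [a _ <-].
apply: le_trans (action_inf_le _ x a) _; apply: bellman_mono; [exact: f0|exact: mf|exact: marel|move=> y].
by apply: ereal_inf_lbound; exists n => //=; rewrite /n; lia.
Qed.
Let acoe (x : borel X) : action_inf (bellman q g u) x = W + u x.
Proof.
apply/eqP; rewrite eq_le; apply/andP; split.
  have [a] := optimality_inequality_ge x.
  by apply: le_trans; exact: action_inf_le.
by apply: le_ereal_inf_tmp => _ [a _ <-]; exact: optimality_inequality_le.
Qed.

Let u_limit_ge0 (y : borel X) : 0 <= u y. Proof. exact: relative_limit_ge0. Qed.

(** The total cost of [g] over [N] steps is at most [u x] plus [N] times [W]; since [u x] is finite,
    its share disappears in the average. *)
Lemma average_cost_stationary_le (phi : borel X -> borel A)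
    (mphi : measurable_fun [set: borel X] phi) (x : X) :
  (forall y, bellman q g u (y, phi y) = W + u y) ->
  average_cost c q (stationary_policy mphi) x <= W + M%:E.
Proof.
move=> phiE; set pi := stationary_policy mphi.
have sum_le N : \sum_(0 <= t < N) stage_cost (strategic_measure q pi x) g t <=
    u x + (N%:R * fine W)%:E.
  have := @stationary_upper_bound _ _ _ q pi x _ (strategic_measureP q pi x) g 1
    (fine W) u phi N ler01 (fine_ge0 vanishing_discount_ge0) g0 mg u_limit_ge0
    measurable_relative_limit mphi (fun t h D mD => erefl).
  have -> : (\sum_(0 <= t < N) 1 ^+ t * fine W)%R = (N%:R * fine W)%R :> R.
    under eq_bigr do rewrite expr1n mul1r.
    by rewrite big_const_nat subn0 iter_addr_0 mulr_natl.
  under [X in (_ -> X <= _) -> _]eq_bigr do rewrite expr1n mul1e.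
  apply => y; rewrite fineK// -phiE; apply: bellman_mono => //.
  - by move=> z; rewrite mul1e.
  - by apply: measurable_funeM; exact: measurable_relative_limit.
  - exact: measurable_relative_limit.
  - by move=> z; rewrite mul1e.
apply/lee_addgt0Pr => e e0; apply: limn_esup_le_near.
have ux := fineK (relative_limit_fin x).
(* From this horizon on, [u x] is at most [e * N]. *)
exists (Num.truncn (fine (u x) / e)).+1 => // N /= NN.
have N0 : (0 < N%:R :> R)%R by rewrite ltr0n (leq_ltn_trans _ NN).
have uN : (fine (u x) <= e * N%:R)%R.
  rewrite mulrC -ler_pdivrMr//; apply: (@le_trans _ _ (Num.truncn (fine (u x) / e)).+1%:R%R).
    by rewrite ltW// truncnS_gt.
  by rewrite ler_nat.
rewrite finite_horizon_cost_shift//.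
apply: (@le_trans _ _ ((N%:R^-1)%:E * (u x + (N%:R * fine W)%:E + (N%:R * M)%:E))).
  by rewrite lee_wpmul2l ?lee_fin ?invr_ge0 ?(ltW N0)// leeD2r.
rewrite -ux -[in leRHS](fineK W_fin) -!EFinD -EFinM lee_fin.
rewrite ler_pdivrMl//; lra.
Qed.

Lemma average_cost_optimality_equation :
  exists phi : borel X -> borel A,
    measurable_fun [set: borel X] phi /\
    forall x : X,
      wstar c q + u x = c (x, phi x) + \int[q (x, phi x)]_y u y /\
      forall a : A,
        c (x, phi x) + \int[q (x, phi x)]_y u y <= c (x, a) + \int[q (x, a)]_y u y.
Proof.
have [||||phi [mphi phiE]] := @measurable_minimizer _ _ _ polishX polishA (bellman q g u).
- by move=> z; exact: bellman_ge0.
- by apply: measurable_bellman => //; exact: measurable_relative_limit.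
- by move=> x l; apply: compact_level_bellman => //; exact: measurable_relative_limit.
- move=> x; rewrite acoe lte_add_pinfty// -ge0_fin_numE ?vanishing_discount_ge0//.
  exact: relative_limit_fin.
have phi_acoe y : bellman q g u (y, phi y) = W + u y by rewrite phiE acoe.
have wstarE : wstar c q = W + M%:E.
  apply/eqP; rewrite eq_le; apply/andP; split.
    (* Any state serves, since the bound on the average cost does not depend on it. *)
    apply: (@le_trans _ _ (average_cost c q (stationary_policy mphi) point)).
      apply: (@le_trans _ _ (average_value c q point)).
        by apply: ereal_inf_lbound; exists point.
      by apply: ereal_inf_lbound; eexists.
    exact: average_cost_stationary_le.
  rewrite leNgt; apply/negP => wlt.
  (* A real level strictly between [wstar] and [W + M] contradicts [vanishing_discount_le]; if
     [wstar] were -oo, any real below [W + M] would do. *)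
  have [l] : exists l : R, wstar c q < l%:E /\ l%:E < W + M%:E.
    move: wlt; rewrite -(fineK W_fin) -EFinD.
    case: (wstar c q) => [s| |]//; rewrite ?lte_fin => h.
      by exists ((s + (fine W + M)) / 2)%R; rewrite !lte_fin; split; lra.
    by exists (fine W + M - 1)%R; split; [exact: ltNyr|rewrite lte_fin; lra].
  move=> [/vanishing_discount_le]; rewrite -(fineK W_fin) -EFinD lee_fin lte_fin; lra.
have cE x a : c (x, a) + \int[q (x, a)]_y u y = bellman q g u (x, a) + M%:E.
  by rewrite /bellman addeAC.
exists phi; split => // x; rewrite cE; split=> [|a].
  by rewrite phi_acoe wstarE addeAC.
by rewrite cE leeD2r// phiE; exact: action_inf_le.
Qed.

End discount_sequence.
End vanishing_discount.

Theorem theorem7p7 (R : realType) (X A : ptopologicalType)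
    (polishX : borel_subset_of_polish R X)
    (polishA : borel_subset_of_polish R A)
    (c : borel X * borel A -> \bar R)
    (c_measurable : measurable_fun [set: borel X * borel A] c)
    (c_bounded_below : bounded_below c)
    (q : R.-pker (borel X * borel A) ~> borel X)
    (Sstar : assumption_Sstar c q)
    (B : assumption_B c q)
    (alpha : nat -> R)
    (alpha_range : forall n, (0 <= alpha n < 1)%R)
    (alpha_nondecreasing : nondecreasing_seq alpha)
    (alpha_cvg : alpha @ \oo --> (1%R : R))
    (u_cvg : forall x : X, cvgn (fun n => relative_value c q (alpha n) x))
    (u_aui : forall (x : X) (a : A),
       asymptotically_uniformly_integrable (q (x, a))
         (fun n => relative_value c q (alpha n))) :
  let u := fun x : X => limn_einf (fun n => relative_value c q (alpha n) x) in
  exists phi : borel X -> borel A,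
    measurable_fun [set: borel X] phi /\
    forall x : X,
      wstar c q + u x = c (x, phi x) + \int[q (x, phi x)]_y u y /\
      forall a : A,
        c (x, phi x) + \int[q (x, phi x)]_y u y <=
        c (x, a) + \int[q (x, a)]_y u y.
Proof.
move=> u.
have [M cM] := c_bounded_below.
pose g z := c z - M%:E.
have cE : c = fun z => g z + M%:E by apply/funext => z; rewrite /g subeK.
have g0 z : 0 <= g z by rewrite /g sube_ge0.
have mg : measurable_fun [set: borel X * borel A] g by exact: emeasurable_funB.
have [c_compact q_setwise] := Sstar.
have cg (x : X) l : compact [set a : A | g (x, a) <= l%:E].
  have -> : [set a : A | g (x, a) <= l%:E] = [set a : A | c (x, a) <= (l + M)%:E].
    by apply/seteqP; split => a /=; rewrite /g leeBlDr// EFinD.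
  exact: c_compact.
rewrite {}/u; move: B u_cvg u_aui; rewrite cE => B' u_cvg' u_aui'.
exact: (average_cost_optimality_equation polishX polishA q_setwise g0 mg cg B'
  alpha_range alpha_cvg u_cvg' u_aui').
Qed.
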